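(* Let $\alpha,\beta,q,r$ be real numbers with $$\tfrac13<\alpha\le 1,\quad 0\le\beta\le 1,\quad 3\alpha+2\beta\ge 2,\quad q>\max\Big(3+\frac{2(1+\beta)}{\alpha},\,3+\frac{6\beta}{3\alpha-1}\Big),$$ $$r\in\Big(3,\;3\alpha+2-\frac{3(3\alpha+2\beta-1)}{q}\Big)\cup(5,\infty).$$ There is a constant $C_{Lip}>0$ depending only on $q,\alpha,\beta$ such that, for all sufficiently small $\varepsilon>0$ and all $f,g\in\Omega$ (the solution space with parameter $\varepsilon$ defined in the context), at every time $t\ge0$, $$\|\nu_{\alpha,\beta}(f)\mathcal M(f)-\nu_{\alpha,\beta}(g)\mathcal M(g)\|_{L^1_2}+\|\nu_{\alpha,\beta}(f)f-\nu_{\alpha,\beta}(g)g\|_{L^1_2}\le C_{Lip}\,\varepsilon^{\alpha}\,\|f-g\|_{L^1_2},$$ where all functions are evaluated at time $t$.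
   Context: Here $t\ge0$ and $x,v\in\mathbb{R}^3$. For a nonnegative function $f(t,x,v)$, define $\rho_f(t,x)$, $U_f(t,x)\in\mathbb{R}^3$, $T_f(t,x)$ by $$\rho_f=\int_{\mathbb{R}^3} f\,dv,\qquad \rho_fU_f=\int_{\mathbb{R}^3} v f\,dv,\qquad \rho_f(|U_f|^2+3T_f)=\int_{\mathbb{R}^3}|v|^2f\,dv,$$ and $$\mathcal M(f)=\frac{\rho_f}{(2\pi T_f)^{3/2}}\exp\Big(-\frac{|v-U_f|^2}{2T_f}\Big),\qquad \nu_{\alpha,\beta}(f)=\rho_f^{\alpha}T_f^{\beta},$$ with the convention $\mathcal M(f)=0$ and $\nu_{\alpha,\beta}(f)=0$ at points where $\rho_f=0$. Weights and norms: $w_a(v)=(1+|v|^2)^{a/2}$, $W_a(t,x,v)=(1+|x-vt|^2+|v|^2)^{a/2}$, $$\|f(t)\|_{w_a}=\sup_{x,v}|w_a(v)f(t,x,v)|,\quad \|f(t)\|_{W_a}=\sup_{x,v}|W_a(t,x,v)f(t,x,v)|,\quad \|f(t)\|_{L^1_2}=\int_{\mathbb{R}^6}(1+|v|^2)|f(t,x,v)|\,dx\,dv,$$ and $L^1_2=L^1_2(\mathbb{R}^6)$ is the space of measurable functions with finite $\|\cdot\|_{L^1_2}$. Solution space: let $f_0=f_0(x,v)\ge0$ be a given initial datum with $\|f_0\|_{L^1_2}<\infty$, and let $C_{r,q}>0$ be a fixed constant. For $\varepsilon>0$, $\Omega$ is the set of $f\in C([0,\infty);L^1_2(\mathbb{R}^6))$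 such that (A1) $f$ is nonnegative; (A2) $\sup_t\|f(t)\|_{w_q}\le\varepsilon$ and $\sup_t\|f(t)\|_{W_r}\le\varepsilon$; (A3) $\nu_{\alpha,\beta}(f)(t,x)\le C_{r,q}\,\varepsilon^{\alpha}(1+t^2)^{-\frac{3\alpha}{2}+\frac{3\beta}{q-3}}$ for all $t,x$; (A4) $\sup_t\|f(t)\|_{L^1_2}\le 2\|f_0\|_{L^1_2}$. *)

(* Defs.v *)
From HB Require Import structures.
From mathcomp Require Import all_boot all_order all_algebra.
From mathcomp Require Import all_classical all_reals all_analysis.
From mathcomp Require Import ring.
Set Implicit Arguments.
Unset Strict Implicit.
Unset Printing Implicit Defensive.
Import Order.TTheory GRing.Theory Num.Theory numFieldNormedType.Exports.
Local Open Scope classical_set_scope.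
Local Open Scope ring_scope.

(* Triples of reals. The norm that the library puts on products is the sup norm,
   so the Euclidean norm is written out in [sqnorm]. *)
Notation R3 R := (R * R * R)%type.

(* The same type with the measurable structure on which [lebesgue_measure] is
   defined; the product sigma-algebra is the Borel one. *)
Notation mR R := (measurableTypeR R).
Notation mR3 R := (mR R * mR R * mR R)%type.

(* The library's instance for product measures is shadowed by the one for
   probabilities, so sigma-finiteness is not inferred. *)
Lemma sigma_finite_prod d1 d2 (T1 : measurableType d1) (T2 : measurableType d2)
    (R : realType) (m1 : {sigma_finite_measure set T1 -> \bar R})
    (m2 : {sigma_finite_measure set T2 -> \bar R}) :
  sigma_finite setT (m1 \x m2)%E.
Proof.
have /sigma_finiteP[F [TF ndF Foo]] := sigma_finiteT m1.
have /sigma_finiteP[G [TG ndG Goo]] := sigma_finiteT m2.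
exists (fun n => F n `*` G n).
  rewrite -setXTT TF TG predeqE => -[x y]; split.
    move=> [/= [n _ Fnx] [k _ Gky]]; exists (maxn n k) => //; split.
    - by move: x Fnx; exact/subsetPset/ndF/leq_maxl.
    - by move: y Gky; exact/subsetPset/ndG/leq_maxr.
  by move=> [n _ []/= ? ?]; split; exists n.
move=> k; have [? ?] := Foo k; have [? ?] := Goo k.
split; first exact: measurableX.
by rewrite product_measure1E// lte_mul_pinfty// ge0_fin_numE.
Qed.

Definition leb2 {R : realType} : set (mR R * mR R)%type -> \bar R :=
  (@lebesgue_measure R \x @lebesgue_measure R)%E.
HB.instance Definition _ (R : realType) := Measure.on (@leb2 R).
HB.instance Definition _ (R : realType) := Measure_isSigmaFinite.Build _ _ _
  (@leb2 R) (sigma_finite_prod (@lebesgue_measure R) (@lebesgue_measure R)).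

Definition leb3 {R : realType} : set (mR3 R) -> \bar R :=
  (@leb2 R \x @lebesgue_measure R)%E.
HB.instance Definition _ (R : realType) := Measure.on (@leb3 R).
HB.instance Definition _ (R : realType) := Measure_isSigmaFinite.Build _ _ _
  (@leb3 R) (sigma_finite_prod (@leb2 R) (@lebesgue_measure R)).

Section Defs.
Context {R : realType}.
Implicit Types (h : R3 R -> R) (k : R3 R -> R3 R -> R)
  (f : R -> R3 R -> R3 R -> R) (x v : R3 R).

Definition sqnorm v : R := v.1.1 ^+ 2 + v.1.2 ^+ 2 + v.2 ^+ 2.

(* Moments of a velocity distribution [h], to be used with [h := f t x].
   [velocity] and [temperature] solve the defining relations of U and T where
   the density is nonzero (see [momentsP]); their values where it is 0 are
   never used. *)
Definition density h : R := \int[leb3]_v h v.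

Definition velocity h : R3 R :=
  ((\int[leb3]_v (v.1.1 * h v)) / density h,
   (\int[leb3]_v (v.1.2 * h v)) / density h,
   (\int[leb3]_v (v.2 * h v)) / density h).

Definition temperature h : R :=
  ((\int[leb3]_v (sqnorm v * h v)) / density h - sqnorm (velocity h)) / 3.

Lemma momentsP h : density h != 0 ->
  [/\ density h * (velocity h).1.1 = \int[leb3]_v (v.1.1 * h v),
      density h * (velocity h).1.2 = \int[leb3]_v (v.1.2 * h v),
      density h * (velocity h).2 = \int[leb3]_v (v.2 * h v)
    & density h * (sqnorm (velocity h) + 3 * temperature h)
      = \int[leb3]_v (sqnorm v * h v)].
Proof.
move=> h0; rewrite /temperature; split; [by rewrite mulrCA divff ?mulr1..|].
by field.
Qed.

Definition maxwellian h v : R :=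
  if density h == 0 then 0
  else density h / (2 * pi * temperature h) `^ (3 / 2)
       * expR (- (sqnorm (v - velocity h) / (2 * temperature h))).

Definition collfreq (alpha beta : R) h : R :=
  if density h == 0 then 0
  else density h `^ alpha * temperature h `^ beta.

Definition weight_w (a : R) v : R := (1 + sqnorm v) `^ (a / 2).

Definition weight_W (a t : R) x v : R :=
  (1 + sqnorm (x - t *: v) + sqnorm v) `^ (a / 2).

Definition norm_w (a : R) k : \bar R :=
  ereal_sup (range (fun z => `|weight_w a z.2 * k z.1 z.2|%:E)).

(* The weight depends on time, hence the extra argument [t]. *)
Definition norm_W (a t : R) k : \bar R :=
  ereal_sup (range (fun z => `|weight_W a t z.1 z.2 * k z.1 z.2|%:E)).

Definition norm_L12 k : \bar R :=
  (\int[leb3 \x leb3]_z ((1 + sqnorm z.2) * `|k z.1 z.2|)%:E)%E.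

Definition sup_time (N : R -> \bar R) : \bar R :=
  ereal_sup [set N t | t in [set t : R | 0 <= t]].

Definition L12 k : Prop :=
  measurable_fun [set: mR3 R * mR3 R] (fun z => k z.1 z.2)
  /\ (norm_L12 k < +oo)%E.

Definition continuous_L12 f : Prop :=
  (forall t : R, 0 <= t -> L12 (f t)) /\
  (forall s : R, 0 <= s ->
     (fun t : R => norm_L12 (fun x v => f t x v - f s x v))
       @ within [set t : R | 0 <= t] (nbhs s) --> 0%E).

(* [C] is a fixed constant, which may depend on [r] and [q]. *)
Definition Omega (alpha beta q r C : R) (f0 : R3 R -> R3 R -> R) (eps : R) f
    : Prop :=
  [/\ continuous_L12 f,
      (forall (t : R) x v, 0 <= t -> 0 <= f t x v),
      (sup_time (fun t : R => norm_w q (f t)) <= eps%:E)%E /\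
      (sup_time (fun t : R => norm_W r t (f t)) <= eps%:E)%E,
      (forall (t : R) x, 0 <= t ->
         collfreq alpha beta (f t x) <=
         C * eps `^ alpha
         * (1 + t ^+ 2) `^ (- (3 * alpha / 2) + 3 * beta / (q - 3)))
    & (sup_time (fun t : R => norm_L12 (f t))
       <= 2%:E * norm_L12 f0)%E].

End Defs.

(* Main.v *)
Require Import Defs.
From HB Require Import structures.
From mathcomp Require Import all_boot all_order all_algebra.
From mathcomp Require Import all_classical all_reals all_analysis.
From mathcomp Require Import measurable_realfun.
From mathcomp Require Import ring lra.
Set Implicit Arguments.
Unset Strict Implicit.
Unset Printing Implicit Defensive.
Import Order.TTheory GRing.Theory Num.Theory numFieldNormedType.Exports.
Local Open Scope classical_set_scope.
Local Open Scope ring_scope.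

(** The estimate holds separately at each time and position. By Tonelli it is
    enough to compare, in the velocity norm with weight [1 + |v|^2], the terms
    built from two velocity distributions [h1], [h2] that lie between [0] and
    [eps * (1 + |v|^2)^(-q/2)], and to bound the result by [eps^alpha] times
    the distance [dlt] of [h1] and [h2].

    Write [rho], [U], [T] for the moments and [K = 1 + |U|^2 + 3 T], so that
    the weighted mass is [rho K]. Both the Maxwellian term and the loss term
    are controlled by [nu rho K], and their variation, up to a term [nu dlt],
    by [nu rho K] times the relative variation
    [|d rho|/rho + |dT|/T + |dU|/sqrt T] of the moments. In turn [rho T] times
    this relative variation is at most a multiple of [K dlt], because moments
    are integrals of polynomials against the distributions ([small_or_close]).
    Since [nu = rho^alpha T^beta], the factor left in front of [dlt] is
    [rho^alpha T^(beta - 1) K^2], and the whole estimate reduces to bounding it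
    by [eps^alpha] ([stiffness_le]). For hot states the decay of the
    distribution gives [rho <= C eps K^(-(q-3)/2)] ([density_energy]); for cold
    states at least half of the particles sit in a ball around [U] of radius
    comparable to [sqrt T], which gives [rho <= C eps K^(-q/2) T^(3/2)]
    ([density_cold]). The remaining power of [T] is nonnegative because
    [3 alpha + 2 beta >= 2], and the remaining power of [K] is nonpositive
    because [alpha (q - 3) >= 2 (1 + beta)].

    Differentiating along the segment from [h1] to [h2] is avoided by a
    dichotomy. Either [rho T] is at most a multiple of [K dlt], and then each
    term is by itself as small as the claimed bound; or the moments of the two
    states are within fixed ratios of each other, and then differences of
    powers and of Gaussians are estimated explicitly ([gain_close],
    [loss_close]). [lipschitz_scheme] makes this argument once for both terms.
    All velocity integrals are reduced to the scaling estimate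
    [integral_bracket_le]. *)

(** * Integrals of power kernels *)

Section kernel1.
Context {R : realType}.
Notation mu := (@lebesgue_measure R).

(** Keeping centre and scale in the integrand makes a change of variables in
    dimension three unnecessary: the antiderivative is explicit. *)
Lemma integral_powR_tail (s sg a : R) : 1 < s -> 0 < sg ->
  (\int[mu]_(y in `[a, +oo[) ((1 + (y - a) / sg) `^ (- s))%:E
   = (sg / (s - 1))%:E)%E.
Proof.
move=> s1 sg0.
have base0 y : a <= y -> 0 < 1 + (y - a) / sg.
  by move=> ay; rewrite ltr_pwDl// divr_ge0 ?subr_ge0// ltW.
pose F y := - (sg / (s - 1)) * (1 + (y - a) / sg) `^ (1 - s).
have dB y : is_derive y (1 : R) (fun y => 1 + (y - a) / sg) sg^-1.
  by apply: is_derive_eq; rewrite scaler0 subr0 !add0r mul1r /GRing.scale/= mulr1.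
have dP p y : a <= y -> is_derive y (1 : R) (fun y => (1 + (y - a) / sg) `^ p)
    (p * (1 + (y - a) / sg) `^ (p - 1) * sg^-1).
  move=> ay; have := @is_derive1_powR R p _ (base0 _ ay) => dp.
  exact: (@is_derive1_comp _ (fun z => z `^ p) (fun y => 1 + (y - a) / sg)).
have cP p y : a <= y -> {for y, continuous (fun y => (1 + (y - a) / sg) `^ p)}.
  move=> ay; apply/differentiable_continuous/derivable1_diffP.
  by have [] := dP p _ ay.
rewrite (@ge0_continuous_FTC2y _ _ F _ 0).
- rewrite /F subrr mul0r addr0 powR1 mulr1 EFinN oppeK add0e//.
- by move=> y _; exact: powR_ge0.
- apply: continuous_in_subspaceT => y; rewrite inE/= in_itv/= andbT => ay.
  exact: cP.
- rewrite /F -(mulr0 (- (sg / (s - 1)))); apply: cvgMr.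
  have -> : (fun y => (1 + (y - a) / sg) `^ (1 - s)) =
      (fun y => ((1 + (y - a) / sg) `^ (s - 1))^-1).
    by apply/funext => y; rewrite -powRN opprB.
  apply/gtr0_cvgV0.
    near=> y; apply: powR_gt0; apply: base0; near: y; apply: nbhs_pinfty_ge; exact: num_real.
  apply/cvgryPge => A; near=> y.
  have ay : a <= y by near: y; apply: nbhs_pinfty_ge; exact: num_real.
  have [A0|A0] := leP A 0; first exact: le_trans A0 (powR_ge0 _ _).
  have -> : A = (A `^ ((s - 1)^-1)) `^ (s - 1).
    by rewrite -powRrM mulVf ?powRr1 ?ltW// gt_eqF// subr_gt0.
  apply: ge0_ler_powR; rewrite ?nnegrE ?powR_ge0 ?subr_ge0 ?ltW ?base0//.
  apply: (@le_lt_trans _ _ ((y - a) / sg)); last by rewrite ltrDr.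
  rewrite ler_pdivlMr// lerBrDr; near: y; apply: nbhs_pinfty_ge; exact: num_real.
- move=> y ay; apply: derivableM => //.
  by have [] := dP (1 - s) y (ltW ay).
- apply/cvg_at_right_filter; apply: cvgMr; exact: cP.
- move=> y; rewrite in_itv/= andbT => ay.
  have := dP (1 - s) _ (ltW ay) => dy.
  rewrite derive1E /F derive_val /GRing.scale/=.
  rewrite (_ : 1 - s - 1 = - s); last by ring.
  have s10 : s - 1 != 0 by rewrite subr_eq0 gt_eqF.
  by field; rewrite s10 gt_eqF.
Unshelve. all: by end_near. Qed.

Lemma integral_cauchy_kernel (s sg a : R) : 1 < s -> 0 < sg ->
  (\int[mu]_y ((1 + `|y - a| / sg) `^ (- s))%:E
   = (2 * (sg / (s - 1)))%:E)%E.
Proof.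
move=> s1 sg0.
pose k y := (1 + `|y - a| / sg) `^ (- s).
have ck : continuous k.
  move=> y; rewrite /k.
  apply: (@continuous_comp _ _ _ (fun y => 1 + `|y - a| / sg) (fun z => z `^ (- s))).
    apply: cvgD; first exact: cvg_cst.
    by apply: cvgMl; apply: cvg_norm; apply: cvgB => //; exact: cvg_cst.
  apply/differentiable_continuous/derivable1_diffP.
  have base0 : 0 < 1 + `|y - a| / sg by rewrite ltr_pwDl// divr_ge0// ltW.
  by have [] := @is_derive1_powR R (- s) _ base0.
have mk : measurable_fun setT k by exact: continuous_measurable_fun.
have tail b : (\int[mu]_(y in `[b, +oo[) ((1 + `|y - b| / sg) `^ (- s))%:E
   = (sg / (s - 1))%:E)%E.
  rewrite -(integral_powR_tail b s1 sg0); apply: eq_integral => y.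
  by rewrite inE/= in_itv/= andbT => ay; rewrite ger0_norm// subr_ge0.
rewrite -(setUv `[a, +oo[%classic) ge0_integral_setU//=; last 4 first.
- exact: measurableC.
- by apply/measurable_EFinP; rewrite setUv.
- by move=> y _; rewrite lee_fin powR_ge0.
- exact/disj_setPCl.
rewrite tail setCitvr.
rewrite integral_itv_bndo_bndc; last by apply/measurable_EFinP/measurable_funTS.
have := @ge0_integration_by_substitutionNy R k (- a).
rewrite opprK => ->; last 2 first.
- exact: continuous_subspaceT.
- by move=> y _; exact: powR_ge0.
rewrite mulr_natl mulr2n EFinD; congr (_ + _)%E; rewrite -(tail (- a)).
apply: eq_integral => y _; rewrite /k/=.
by rewrite opprK -normrN opprD !opprK.
Qed.
End kernel1.

Lemma ler_powRN {R : realType} (r x y : R) : 0 <= r -> 0 < x -> x <= y ->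
  y `^ (- r) <= x `^ (- r).
Proof.
move=> r0 x0 xy; rewrite !powRN lef_pV2 ?posrE ?powR_gt0 ?(lt_le_trans x0 xy)//.
by apply: ge0_ler_powR => //; rewrite nnegrE ltW// (lt_le_trans x0 xy).
Qed.

Lemma powRV {R : realType} (x r : R) : 0 <= x -> x^-1 `^ (- r) = x `^ r.
Proof. by move=> x0; rewrite -powR_inv1// -powRrM mulN1r opprK. Qed.

Section kernel3.
Context {R : realType}.
Notation mu := (@lebesgue_measure R).

Lemma sqnorm_ge0 (v : R3 R) : 0 <= sqnorm v.
Proof. by rewrite /sqnorm !addr_ge0// sqr_ge0. Qed.

Lemma integral_leb3_prod (f g h : R -> R) (A B C : R) :
  measurable_fun setT f -> measurable_fun setT g -> measurable_fun setT h ->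
  (forall y, 0 <= f y) -> (forall y, 0 <= g y) -> (forall y, 0 <= h y) ->
  (\int[mu]_y (f y)%:E = A%:E)%E -> (\int[mu]_y (g y)%:E = B%:E)%E ->
  (\int[mu]_y (h y)%:E = C%:E)%E ->
  (\int[leb3]_v (f v.1.1 * g v.1.2 * h v.2)%:E = (A * B * C)%:E)%E.
Proof.
move=> mf mg mh f0 g0 h0 fA gB hC.
have m11 : measurable_fun setT (fun v : mR R * mR R => f v.1 * g v.2).
  by apply: measurable_funM; apply: measurableT_comp.
rewrite /leb3 (fubini_tonelli1 (fun v : mR3 R => (f v.1.1 * g v.1.2 * h v.2)%:E)).
- rewrite /fubini_F/=.
  under eq_integral => x _.
    under eq_integral do rewrite EFinM.
    rewrite ge0_integralZl//; last 3 first.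
    - exact/measurable_EFinP.
    - by move=> y _; rewrite lee_fin.
    - by rewrite lee_fin mulr_ge0.
    rewrite hC; over.
  rewrite ge0_integralZr//; last 3 first.
  - exact/measurable_EFinP.
  - by move=> x _; rewrite lee_fin mulr_ge0.
  - by rewrite -hC integral_ge0// => y _; rewrite lee_fin.
  rewrite [RHS]EFinM; congr (_ * _)%E.
  rewrite /leb2 (fubini_tonelli1 (fun v : mR R * mR R => (f v.1 * g v.2)%:E)).
  + rewrite /fubini_F/=.
    under eq_integral => x _.
      under eq_integral do rewrite EFinM.
      rewrite ge0_integralZl//; last 3 first.
      - exact/measurable_EFinP.
      - by move=> y _; rewrite lee_fin.
      - by rewrite lee_fin.
      rewrite gB; over.
    rewrite ge0_integralZr ?fA//.
    - exact/measurable_EFinP.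
    - by move=> x _; rewrite lee_fin.
    - by rewrite -gB integral_ge0// => y _; rewrite lee_fin.
  + exact/measurable_EFinP.
  + by move=> x; rewrite lee_fin mulr_ge0.
- apply/measurable_EFinP; apply: measurable_funM.
    exact: (measurableT_comp m11).
  exact: measurableT_comp.
- by move=> x; rewrite lee_fin !mulr_ge0.
Qed.

Lemma sqnormBE (v a : R3 R) : sqnorm (v - a)
  = (v.1.1 - a.1.1) ^+ 2 + (v.1.2 - a.1.2) ^+ 2 + (v.2 - a.2) ^+ 2.
Proof. by []. Qed.

Lemma measurable_sqnormB d (T : measurableType d) (F : T -> mR3 R) (a : R3 R) :
  measurable_fun setT F -> measurable_fun setT (fun x => sqnorm ((F x : R3 R) - a)).
Proof.
move=> mF; under eq_fun do rewrite sqnormBE.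
have mF1 : measurable_fun setT (fun x => (F x).1) by exact: measurableT_comp.
have m11 : measurable_fun setT (fun x => (F x).1.1) by exact: measurableT_comp.
have m12 : measurable_fun setT (fun x => (F x).1.2) by exact: measurableT_comp.
have m2 : measurable_fun setT (fun x => (F x).2) by exact: measurableT_comp.
by do !apply: measurable_funD; apply: measurable_funX; exact: measurable_funB.
Qed.

(** Each of the three factors [1 + x^2] is at most the sum [1 + |v|^2], so a
    sixth of the exponent can be spent on each coordinate; this turns the
    radial kernel into a product of one-dimensional ones. *)
Lemma bracket_le_prod (p : R) (x y z : R) : 0 <= p ->
  (1 + (x ^+ 2 + y ^+ 2 + z ^+ 2)) `^ (- (p / 2)) <=
  2 `^ (p / 2) * ((1 + `|x|) `^ (- (p / 3)) * (1 + `|y|) `^ (- (p / 3))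
                  * (1 + `|z|) `^ (- (p / 3))).
Proof.
move=> p0; set b := 1 + _.
have b1 : 1 <= b by rewrite lerDl !addr_ge0// sqr_ge0.
have fac c : c ^+ 2 <= b - 1 ->
    b `^ (- (p / 6)) <= 2 `^ (p / 6) * (1 + `|c|) `^ (- (p / 3)).
  move=> cb.
  have c0 : 0 < 1 + `|c| by rewrite ltr_pwDl.
  have -> : - (p / 3) = 2 * - (p / 6) by field.
  rewrite (powRrM _ 2) powR_mulrn ?(ltW c0)//.
  rewrite -(powRV (p / 6) (ler0n R 2)) -powRM ?invr_ge0// ?exprn_ge0 ?(ltW c0)//.
  apply: ler_powRN; rewrite ?divr_ge0// ?mulr_gt0 ?invr_gt0 ?exprn_gt0//.
  rewrite ler_pdivrMl// -(real_normK (num_real c)) in cb *.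
  have := sqr_ge0 (1 - `|c|); rewrite sqrrB sqrrD; lra.
have -> : - (p / 2) = - (p / 6) + - (p / 6) + - (p / 6) by field.
have -> : p / 2 = p / 6 + p / 6 + p / 6 by field.
have bn : b != 0 by rewrite gt_eqF// (lt_le_trans _ b1).
rewrite !powRD ?bn ?implybT// ?pnatr_eq0 ?implybT//.
set u := b `^ _; set t := 2 `^ _.
rewrite [leRHS](_ : _ = (t * (1 + `|x|) `^ (- (p / 3))) *
  (t * (1 + `|y|) `^ (- (p / 3))) * (t * (1 + `|z|) `^ (- (p / 3)))); last by ring.
have x2 := sqr_ge0 x; have y2 := sqr_ge0 y; have z2 := sqr_ge0 z.
by apply: ler_pM; rewrite ?mulr_ge0 ?powR_ge0//; [apply: ler_pM; rewrite ?powR_ge0//|];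
   apply: fac; rewrite /b; lra.
Qed.

(** Stated with a free centre and scale, so that it serves the tails ([sg] the
    truncation radius), the balls of Chebyshev estimates and the Gaussians
    ([sg] the thermal speed) alike. The factor [sg ^+ 3] is the volume scaling;
    finiteness needs [p] above the dimension. *)
Lemma integral_bracket_le (p : R) : 3 < p ->
  exists2 J : R, 0 < J & forall (a : R3 R) (sg : R), 0 < sg ->
  (\int[leb3]_v ((1 + sqnorm (v - a) / sg ^+ 2) `^ (- (p / 2)))%:E
   <= (J * sg ^+ 3)%:E)%E.
Proof.
move=> p3; have p31 : 1 < p / 3 by lra.
exists (2 `^ (p / 2) * (2 / (p / 3 - 1)) ^+ 3).
  by rewrite mulr_gt0 ?powR_gt0// exprn_gt0// divr_gt0// subr_gt0.
move=> a sg sg0.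
pose k (b y : R) := (1 + `|y - b| / sg) `^ (- (p / 3)).
have k0 b y : 0 <= k b y by exact: powR_ge0.
have mk b : measurable_fun setT (k b).
  apply: (@measurableT_comp _ _ _ _ _ _ (fun z => z `^ (- (p / 3)))) => //.
  apply: measurable_funD => //; apply: measurable_funM => //.
  by apply: measurableT_comp => //; exact: measurable_funB.
have ik b := integral_cauchy_kernel b p31 sg0.
have ip := integral_leb3_prod (mk a.1.1) (mk a.1.2) (mk a.2) (k0 _) (k0 _) (k0 _)
  (ik _) (ik _) (ik _).
rewrite [leRHS](_ : _ = ((2 `^ (p / 2))%:E *
   \int[leb3]_v (k a.1.1 v.1.1 * k a.1.2 v.1.2 * k a.2 v.2)%:E)%E); last first.
  by rewrite ip -EFinM; congr EFin; field; rewrite gt_eqF// subr_gt0.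
have mp : measurable_fun setT
    (fun v : mR3 R => k a.1.1 v.1.1 * k a.1.2 v.1.2 * k a.2 v.2).
  apply: measurable_funM; [apply: measurable_funM|].
  - by apply: (measurableT_comp (mk _)); exact: measurableT_comp.
  - by apply: (measurableT_comp (mk _)); exact: measurableT_comp.
  - exact: (measurableT_comp (mk _)).
rewrite -ge0_integralZl//; last 2 first.
- exact/measurable_EFinP.
- by move=> v _; rewrite lee_fin !mulr_ge0.
apply: ge0_le_integral => //.
- by move=> v _; rewrite lee_fin powR_ge0.
- apply/measurable_EFinP.
  apply: (@measurableT_comp _ _ _ _ _ _ (fun z => z `^ (- (p / 2)))) => //.
  apply: measurable_funD => //; apply: measurable_funM => //.
  exact: measurable_sqnormB.
- apply/measurable_EFinP; apply: measurable_funM => //.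
- move=> v _; rewrite -EFinM lee_fin /k sqnormBE.
  have -> : forall A B C : R, (A ^+ 2 + B ^+ 2 + C ^+ 2) / sg ^+ 2 =
    (A / sg) ^+ 2 + (B / sg) ^+ 2 + (C / sg) ^+ 2.
    by move=> A B C; field; rewrite gt_eqF.
  have nE y : `|y| / sg = `|y / sg| by rewrite normrM normfV (gtr0_norm sg0).
  by rewrite !nE; apply: bracket_le_prod; lra.
Qed.

End kernel3.

(** * Integration of rapidly decaying velocity distributions *)

Section moments.
Context {R : realType}.
Implicit Types (h k : R3 R -> R) (a u v : R3 R) (p q eps sg : R).

(** The ascription puts on velocity space the measurable structure that carries
    [leb3]. *)
Definition vintegrable h : Prop :=
  (@leb3 R).-integrable setT (EFin \o (h : mR3 R -> R)).

Definition vmeasurable h : Prop := measurable_fun [set: mR3 R] (h : mR3 R -> R).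

Definition bracket v : R := 1 + sqnorm v.

Lemma bracket_ge1 v : 1 <= bracket v.
Proof. by rewrite lerDl sqnorm_ge0. Qed.

Lemma bracket_gt0 v : 0 < bracket v.
Proof. exact: lt_le_trans (bracket_ge1 v). Qed.

Lemma measurable_sqnorm_sub a : vmeasurable (fun v => sqnorm (v - a)).
Proof. exact: measurable_sqnormB. Qed.

Lemma measurable_sqnorm : vmeasurable (@sqnorm R).
Proof.
have := measurable_sqnorm_sub 0.
by rewrite /vmeasurable; under eq_fun do rewrite subr0.
Qed.

Lemma measurable_bracket : vmeasurable bracket.
Proof. by apply: measurable_funD => //; exact: measurable_sqnorm. Qed.

Definition kernel p a sg v : R := (1 + sqnorm (v - a) / sg ^+ 2) `^ (- (p / 2)).

Lemma kernel_ge0 p a sg v : 0 <= kernel p a sg v.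
Proof. exact: powR_ge0. Qed.

Lemma measurable_kernel p a sg : vmeasurable (kernel p a sg).
Proof.
apply: (@measurableT_comp _ _ _ _ _ _ (fun z => z `^ (- (p / 2)))) => //.
apply: measurable_funD => //; apply: measurable_funM => //.
exact: measurable_sqnormB.
Qed.

Lemma vintegrable_kernel p a sg : 3 < p -> 0 < sg -> vintegrable (kernel p a sg).
Proof.
move=> p3 sg0; apply/integrableP; split.
  by apply/measurable_EFinP; exact: measurable_kernel.
have [J _ /(_ a sg sg0) Jle] := integral_bracket_le p3.
under eq_integral do rewrite /= ger0_norm ?kernel_ge0//.
exact: le_lt_trans Jle (ltry _).
Qed.

Lemma Rintegral_kernel_le p : 3 < p ->
  exists2 J : R, 0 < J & forall a sg, 0 < sg ->
  \int[leb3]_v kernel p a sg v <= J * sg ^+ 3.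
Proof.
move=> p3; have [J J0 Jle] := integral_bracket_le p3; exists J => // a sg sg0.
rewrite -lee_fin /Rintegral fineK; first exact: Jle.
by apply: integrable_fin_num => //; exact: vintegrable_kernel.
Qed.

Lemma vintegrableZ (c : R) h : vintegrable h -> vintegrable (fun v => c * h v).
Proof.
move=> ih; have := @integrableZl _ _ _ (@leb3 R) _ measurableT c _ ih.
by apply: eq_integrable.
Qed.

Lemma vintegrableD h k : vintegrable h -> vintegrable k -> vintegrable (fun v => h v + k v).
Proof.
move=> ih ik; have := @integrableD _ _ _ (@leb3 R) _ measurableT _ _ ih ik.
by apply: eq_integrable.
Qed.

Lemma vintegrableB h k : vintegrable h -> vintegrable k -> vintegrable (fun v => h v - k v).
Proof.
move=> ih ik; have := @integrableB _ _ _ (@leb3 R) _ measurableT _ _ ih ik.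
by apply: eq_integrable.
Qed.

Lemma vintegrable_le h k : vmeasurable h -> (forall v, `|h v| <= k v) ->
  vintegrable k -> vintegrable h.
Proof.
move=> mh hk ik; apply: (le_integrable _ _ _ ik) => //.
  exact/measurable_EFinP.
by move=> v _ /=; rewrite lee_fin (le_trans (hk v))// ler_norm.
Qed.

Lemma vintD h k : vintegrable h -> vintegrable k ->
  \int[leb3]_v (h v + k v) = \int[leb3]_v h v + \int[leb3]_v k v.
Proof. by move=> ih ik; rewrite RintegralD. Qed.

Lemma vintB h k : vintegrable h -> vintegrable k ->
  \int[leb3]_v (h v - k v) = \int[leb3]_v h v - \int[leb3]_v k v.
Proof. by move=> ih ik; rewrite RintegralB. Qed.

Lemma vintZ (c : R) h : vintegrable h ->
  \int[leb3]_v (c * h v) = c * \int[leb3]_v h v.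
Proof. by move=> ih; rewrite RintegralZl. Qed.

Lemma vint_le h k : vintegrable h -> vintegrable k -> (forall v, h v <= k v) ->
  \int[leb3]_v h v <= \int[leb3]_v k v.
Proof. by move=> ih ik hk; apply: le_Rintegral => // v _; exact: hk. Qed.

(** The velocity profiles of the solution space: the upper bound says that the
    norm with weight [w_q] is at most [eps]. *)
Definition tame q eps h : Prop :=
  vmeasurable h /\ forall v, 0 <= h v <= eps * bracket v `^ (- (q / 2)).

Lemma bracketM_powR q v :
  bracket v * bracket v `^ (- (q / 2)) = bracket v `^ (- ((q - 2) / 2)).
Proof.
have b0 := bracket_gt0 v.
rewrite -[X in X * _]powRr1 ?(ltW b0)// -powRD.
  by congr (_ `^ _); field.
by rewrite (gt_eqF b0) implybT.
Qed.

(** Multiplying by a function of quadratic growth costs two powers of decay,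
    hence the condition [5 < q] instead of [3 < q]. *)
Lemma tame_integrableM q eps h (k : R3 R -> R) (c : R) : 5 < q -> tame q eps h ->
  vmeasurable k -> (forall v, `|k v| <= c * bracket v) -> vintegrable (fun v => k v * h v).
Proof.
move=> q5 [mh hle] mk kc.
have p3 : 3 < q - 2 by lra.
apply: (@vintegrable_le _ (fun v => c * eps * kernel (q - 2) 0 1 v)).
- exact: measurable_funM.
- move=> v; have /andP[h0 he] := hle v; rewrite normrM (ger0_norm h0).
  apply: (le_trans (ler_pM (normr_ge0 _) h0 (kc v) he)).
  by rewrite mulrACA bracketM_powR /kernel subr0 expr1n divr1.
- by apply: vintegrableZ; exact: vintegrable_kernel.
Qed.

End moments.

(** * Moments and their differences *)

Section tame_moments.
Context {R : realType}.
Implicit Types (h k : R3 R -> R) (a u v : R3 R) (p eps sg : R).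
Variable q : R.
Hypothesis q5 : 5 < q.

Definition mass h : R := \int[leb3]_v (bracket v * h v).

Lemma sqnormB_le v u : sqnorm (v - u) <= 2 * bracket u * bracket v.
Proof.
have := sqnorm_ge0 u; have := sqnorm_ge0 v.
rewrite sqnormBE /bracket /sqnorm => v0 u0.
have := sqr_ge0 (v.1.1 + u.1.1); have := sqr_ge0 (v.1.2 + u.1.2).
have := sqr_ge0 (v.2 + u.2).
have := mulr_ge0 v0 u0; nra.
Qed.

Lemma norm_le_bracket v :
  [/\ `|v.1.1| <= bracket v, `|v.1.2| <= bracket v & `|v.2| <= bracket v].
Proof.
have aux (x : R) : `|x| <= 1 + x ^+ 2.
  have := sqr_ge0 (`|x| - 1); have := normr_ge0 x.
  rewrite sqrrB -[in 1 + x ^+ 2](real_normK (num_real x)); lra.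
have x2 := sqr_ge0 v.1.1; have y2 := sqr_ge0 v.1.2; have z2 := sqr_ge0 v.2.
rewrite /bracket /sqnorm; split.
- by have := aux v.1.1; lra.
- by have := aux v.1.2; lra.
- by have := aux v.2; lra.
Qed.

Section one.
Variables (eps : R) (h : R3 R -> R).
Hypothesis th : tame q eps h.

Lemma tame_measurable : vmeasurable h. Proof. by case: th. Qed.

Lemma tame_ge0 v : 0 <= h v. Proof. by case: th => _ /(_ v)/andP[]. Qed.

Lemma tame_integrable : vintegrable h.
Proof.
have := @tame_integrableM R q eps h (fun=> 1) 1 q5 th.
rewrite (_ : (fun v => 1 * h v) = h); last by apply/funext => v; rewrite mul1r.
apply; first exact: measurable_cst.
by move=> v; rewrite normr1 mul1r bracket_ge1.
Qed.

Lemma tame_integrable_bracket : vintegrable (fun v => bracket v * h v).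
Proof.
apply: (@tame_integrableM R q eps h _ 1 q5 th); first exact: measurable_bracket.
by move=> v; rewrite mul1r ger0_norm// ltW ?bracket_gt0.
Qed.

Lemma tame_integrable_sqnormB u : vintegrable (fun v => sqnorm (v - u) * h v).
Proof.
apply: (@tame_integrableM R q eps h _ (2 * bracket u) q5 th).
  exact: measurable_sqnorm_sub.
by move=> v; rewrite ger0_norm ?sqnorm_ge0// sqnormB_le.
Qed.

Lemma tame_integrable_sqnorm : vintegrable (fun v => sqnorm v * h v).
Proof.
have := tame_integrable_sqnormB 0.
by rewrite /vintegrable; under eq_fun do rewrite subr0.
Qed.

Lemma tame_integrable_coord :
  [/\ vintegrable (fun v => v.1.1 * h v), vintegrable (fun v => v.1.2 * h v)
    & vintegrable (fun v => v.2 * h v)].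
Proof.
split; apply: (@tame_integrableM R q eps h _ 1 q5 th);
  try (by move=> v; rewrite mul1r; have [] := norm_le_bracket v).
- exact: measurableT_comp.
- exact: measurableT_comp.
- exact: measurable_snd.
Qed.

Lemma density_ge0 : 0 <= density h.
Proof. by apply: Rintegral_ge0 => v _; exact: tame_ge0. Qed.

Lemma massE : mass h = density h + \int[leb3]_v (sqnorm v * h v).
Proof.
rewrite /mass /bracket -vintD; [|exact: tame_integrable|exact: tame_integrable_sqnorm].
by apply: eq_Rintegral => v _; rewrite mulrDl mul1r.
Qed.

Lemma density_le_mass : density h <= mass h.
Proof.
rewrite massE lerDl; apply: Rintegral_ge0 => v _.
by rewrite mulr_ge0 ?sqnorm_ge0// tame_ge0.
Qed.

(** The bulk velocity [U] is the centre of mass, so moving the centre [u]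
    off it adds [|U - u|^2] per unit of density. *)
Lemma second_moment u : density h != 0 ->
  \int[leb3]_v (sqnorm (v - u) * h v)
  = density h * (3 * temperature h + sqnorm (velocity h - u)).
Proof.
move=> h0; have [H1 H2 H3 HE] := momentsP h0.
have [i1 i2 i3] := tame_integrable_coord.
pose c1 := - 2 * u.1.1; pose c2 := - 2 * u.1.2; pose c3 := - 2 * u.2.
transitivity (\int[leb3]_v (sqnorm v * h v + (c1 * (v.1.1 * h v)
   + (c2 * (v.1.2 * h v) + (c3 * (v.2 * h v) + sqnorm u * h v))))).
  apply: eq_Rintegral => v _; rewrite sqnormBE /c1 /c2 /c3 /sqnorm; ring.
have is_ := tame_integrable_sqnorm; have ih := tame_integrable.
do ![rewrite vintD; [|by do ?[apply: vintegrableD]; do ?[apply: vintegrableZ]..]].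
rewrite !vintZ//.
rewrite -H1 -H2 -H3 -HE -/(density h) sqnormBE /c1 /c2 /c3 /sqnorm; ring.
Qed.

Lemma mass_density : density h != 0 ->
  mass h = density h * (1 + sqnorm (velocity h) + 3 * temperature h).
Proof.
move=> h0; rewrite massE; have [_ _ _ <-] := momentsP h0; ring.
Qed.

End one.

(** The distance of two tame profiles is tame, so the lemmas on moments also
    apply to it. *)
Lemma tame_dist eps h k : tame q eps h -> tame q eps k ->
  tame q eps (fun v => `|h v - k v|).
Proof.
move=> [mh hle] [mk kle]; split.
  by apply: measurableT_comp => //; exact: measurable_funB.
move=> v; have /andP[h0 he] := hle v; have /andP[k0 ke] := kle v.
by rewrite normr_ge0/= ler_norml; apply/andP; split; lra.
Qed.

Section two.
Variables (eps : R) (h k : R3 R -> R).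
Hypotheses (th : tame q eps h) (tk : tame q eps k).
Let td := tame_dist th tk.

Lemma density_dist : `|density h - density k| <= mass (fun v => `|h v - k v|).
Proof.
rewrite /density -vintB; [|exact: (tame_integrable th)|exact: (tame_integrable tk)].
apply: le_trans (density_le_mass td).
apply: le_normr_Rintegral => //.
by apply: vintegrableB; [exact: (tame_integrable th)|exact: (tame_integrable tk)].
Qed.

(** Leaving [u] free is what later separates the temperature from the bulk
    velocity. *)
Lemma second_moment_dist u :
  `|\int[leb3]_v (sqnorm (v - u) * h v) - \int[leb3]_v (sqnorm (v - u) * k v)|
  <= 2 * bracket u * mass (fun v => `|h v - k v|).
Proof.
have ih := tame_integrable_sqnormB th u; have ik := tame_integrable_sqnormB tk u.
rewrite -vintB// /mass -vintZ; last exact: tame_integrable_bracket td.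
apply: (@le_trans _ _ (\int[leb3]_v (sqnorm (v - u) * `|h v - k v|))).
  have E : \int[leb3]_v `|sqnorm (v - u) * h v - sqnorm (v - u) * k v|
         = \int[leb3]_v (sqnorm (v - u) * `|h v - k v|).
    by apply: eq_Rintegral => v _; rewrite -mulrBr normrM ger0_norm ?sqnorm_ge0.
  rewrite -E; apply: le_normr_Rintegral => //; exact: vintegrableB.
apply: vint_le.
- exact: (tame_integrable_sqnormB td).
- by apply: vintegrableZ; exact: tame_integrable_bracket td.
- by move=> v; rewrite mulrA ler_wpM2r// sqnormB_le.
Qed.

End two.

(** Split where the bracket equals [sg ^+ 2]: below, the bracket is at most
    [sg ^+ 2]; above, it is at least half of [sg ^+ 2 + |v|^2], so the tail is
    a kernel integral at scale [sg]. *)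
Lemma mass_tail : exists2 C : R, 0 < C & forall eps h sg, 0 < eps ->
  tame q eps h -> 0 < sg ->
  mass h <= sg ^+ 2 * density h + C * eps * sg `^ (5 - q).
Proof.
have p3 : 3 < q - 2 by move: q5; lra.
have [J J0 Jle] := @Rintegral_kernel_le R _ p3.
exists (2 `^ ((q - 2) / 2) * J); first by rewrite mulr_gt0 ?powR_gt0.
move=> eps h sg eps0 th sg0.
pose c := eps * (2 `^ ((q - 2) / 2) * sg `^ (- (q - 2))).
have c0 : 0 <= c by rewrite mulr_ge0 ?(ltW eps0)// mulr_ge0 ?powR_ge0.
have ik := vintegrable_kernel (0 : R3 R) p3 sg0.
apply: (@le_trans _ _ (\int[leb3]_v (sg ^+ 2 * h v + c * kernel (q - 2) 0 sg v))).
  apply: vint_le; first exact: tame_integrable_bracket th.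
    by apply: vintegrableD; apply: vintegrableZ => //; exact: tame_integrable th.
  move=> v; have [_ /(_ v)/andP[h0 he]] := th.
  have [bs|bs] := leP (bracket v) (sg ^+ 2).
    apply: ler_wpDr; first by rewrite mulr_ge0// kernel_ge0.
    exact: ler_wpM2r.
  apply: ler_wpDl; first by rewrite mulr_ge0// sqr_ge0.
  apply: (le_trans (ler_wpM2l (ltW (bracket_gt0 v)) he)).
  rewrite mulrCA bracketM_powR /c -!mulrA ler_wpM2l ?(ltW eps0)//.
  have s2 : 0 < sg ^+ 2 by rewrite exprn_gt0.
  have -> : sg `^ (- (q - 2)) = (sg ^+ 2) `^ (- ((q - 2) / 2)).
    by rewrite -powR_mulrn ?(ltW sg0)// -powRrM; congr (_ `^ _); field.
  rewrite -(powRV ((q - 2) / 2) (ler0n R 2)).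
  have n0 := sqnorm_ge0 v; have sgge0 := ltW sg0.
  have k1 : 0 <= 1 + sqnorm (v - 0) / sg ^+ 2.
    by rewrite addr_ge0// divr_ge0 ?sqnorm_ge0// ltW.
  rewrite /kernel -powRM ?(ltW s2)// -powRM ?invr_ge0// ?mulr_ge0 ?(ltW s2)//.
  rewrite subr0 in k1 *.
  have E : 2^-1 * (sg ^+ 2 * (1 + sqnorm v / sg ^+ 2)) = 2^-1 * (sg ^+ 2 + sqnorm v).
    by field; rewrite gt_eqF.
  rewrite E; apply: ler_powRN; first lra.
    by rewrite mulr_gt0// ltr_wpDr.
  rewrite /bracket in bs *; lra.
rewrite vintD; [|by apply: vintegrableZ; exact: tame_integrable th|exact: vintegrableZ].
rewrite !vintZ//; last exact: tame_integrable th.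
rewrite lerD2l; apply: (le_trans (ler_wpM2l c0 (Jle 0 sg sg0))).
rewrite /c.
have -> : sg `^ (5 - q) = sg `^ (- (q - 2)) * sg ^+ 3.
  rewrite -powR_mulrn ?(ltW sg0)// -powRD ?(gt_eqF sg0) ?implybT//.
  by congr (_ `^ _); ring.
by rewrite le_eqVlt; apply/orP; left; apply/eqP; ring.
Qed.

(** Chebyshev: particles at distance more than [sg] from [a] are counted by the
    second moment, the others by the volume of the ball. The indicator of the
    ball is replaced by four times the kernel of exponent [4], which is at least
    one there. *)
Lemma density_concentration : exists2 C : R, 0 < C & forall eps h a sg M,
  tame q eps h -> 0 < sg -> 0 <= M ->
  (forall v, sqnorm (v - a) <= sg ^+ 2 -> h v <= M) ->
  density h <= C * M * sg ^+ 3
               + (\int[leb3]_v (sqnorm (v - a) * h v)) / sg ^+ 2.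
Proof.
have p3 : 3 < 4 :> R by lra.
have [J J0 Jle] := @Rintegral_kernel_le R _ p3.
exists (4 * J); first by rewrite mulr_gt0.
move=> eps h a sg M th sg0 M0 hM.
have ik := vintegrable_kernel a p3 sg0.
have is_ := tame_integrable_sqnormB th a.
have s2 : 0 < sg ^+ 2 by rewrite exprn_gt0.
apply: (@le_trans _ _ (\int[leb3]_v (4 * M * kernel 4 a sg v
   + (sg ^+ 2)^-1 * (sqnorm (v - a) * h v)))).
  apply: vint_le; first exact: tame_integrable th.
    by apply: vintegrableD; apply: vintegrableZ.
  move=> v; have h0 := tame_ge0 th v; have n0 := sqnorm_ge0 (v - a).
  have [vs|vs] := leP (sqnorm (v - a)) (sg ^+ 2).
    apply: ler_wpDr.
      by rewrite mulr_ge0 ?invr_ge0 ?(ltW s2)// mulr_ge0.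
    apply: (le_trans (hM v vs)).
    have -> : 4 * M * kernel 4 a sg v = M * (4 * kernel 4 a sg v) by ring.
    rewrite ler_peMr//.
    have E4 : 4 = (2 ^-1) `^ (- (4 / 2)) :> R.
      rewrite powRV// (_ : 4 / 2 = 2%:R); last by field.
      by rewrite powR_mulrn//; ring.
    have r1 : sqnorm (v - a) / sg ^+ 2 <= 1 by rewrite ler_pdivrMr// mul1r.
    have r0 : 0 <= sqnorm (v - a) / sg ^+ 2 by rewrite divr_ge0// ltW.
    rewrite [X in X * kernel _ _ _ _]E4 /kernel -powRM ?invr_ge0//; last lra.
    have E1 : 1 = 1 `^ (- (4 / 2)) :> R by rewrite powR1.
    rewrite [leLHS]E1.
    apply: ler_powRN; lra.
  apply: ler_wpDl; first by rewrite !mulr_ge0// kernel_ge0.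
  by rewrite mulrA ler_peMl// ler_pdivlMl// mulr1 ltW.
rewrite vintD; [|exact: vintegrableZ|exact: vintegrableZ].
rewrite !vintZ//; rewrite [X in _ + X]mulrC lerD2r.
have -> : 4 * J * M * sg ^+ 3 = 4 * M * (J * sg ^+ 3) by ring.
by rewrite ler_wpM2l ?mulr_ge0// Jle.
Qed.

End tame_moments.

(** * Density against energy and temperature *)

Lemma powR_add {R : realType} (x r s : R) : 0 < x -> x `^ (r + s) = x `^ r * x `^ s.
Proof. by move=> x0; rewrite powRD// (gt_eqF x0) implybT. Qed.

Section moment_bounds.
Context {R : realType}.
Implicit Types (h k : R3 R -> R) (a u v : R3 R) (eps sg : R).
Variable q : R.
Hypothesis q5 : 5 < q.

(** The mean of [bracket] over the particles, see [mass_energy]. *)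
Definition energy h : R := bracket (velocity h) + 3 * temperature h.

Lemma mass_energy eps h : tame q eps h -> density h != 0 ->
  mass h = density h * energy h.
Proof. by move=> th h0; rewrite (mass_density q5 th). Qed.

Lemma central_moment eps h : tame q eps h -> density h != 0 ->
  \int[leb3]_v (sqnorm (v - velocity h) * h v) = 3 * (density h * temperature h).
Proof.
move=> th h0; rewrite (second_moment q5 th)// subrr.
by rewrite /sqnorm/= expr0n/= !addr0; ring.
Qed.

(** At zero temperature all particles would sit at one point, which a bounded
    distribution with positive density excludes: let the radius of
    [density_concentration] tend to zero. *)
Lemma temperature_gt0 eps h : 0 < eps -> tame q eps h -> 0 < density h ->
  0 < temperature h.
Proof.
move=> eps0 th h0; have [C C0 hC] := @density_concentration R q q5.
have hn : density h != 0 by rewrite gt_eqF.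
rewrite ltNge; apply/negP => T0.
have Ce : 0 < C * eps by rewrite mulr_gt0.
(* small enough that the ball of radius [sg] holds at most half of the density *)
pose sg := Num.min 1 (density h / (2 * (C * eps))).
have sg0 : 0 < sg by rewrite lt_min ltr01 divr_gt0// mulr_gt0.
have sg1 : sg <= 1 by rewrite ge_min lexx.
have sgr : sg <= density h / (2 * (C * eps)) by rewrite ge_min lexx orbT.
have hle v : h v <= eps.
  have [_ /(_ v)/andP[_ he]] := th; apply: (le_trans he).
  rewrite ler_piMr ?(ltW eps0)// powRN invf_le1 ?powR_gt0 ?bracket_gt0//.
  rewrite -[leLHS](powRr0 (bracket v)) ler_powR ?bracket_ge1//.
  by move: q5; lra.
have := hC eps h (velocity h) sg eps th sg0 (ltW eps0) (fun v _ => hle v).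
rewrite (central_moment th hn) leNgt => /negP; apply.
have le0 : 3 * (density h * temperature h) / sg ^+ 2 <= 0.
  rewrite pmulr_lle0 ?invr_gt0 ?exprn_gt0// pmulr_rle0// pmulr_rle0//.
have : C * eps * sg ^+ 3 <= C * eps * sg.
  rewrite ler_wpM2l ?(ltW Ce)// -[leRHS]mulr1 exprS ler_wpM2l ?(ltW sg0)//.
  by rewrite expr_le1// ltW.
have : C * eps * sg <= density h / 2.
  rewrite (le_trans (ler_wpM2l (ltW Ce) sgr))//.
  by rewrite le_eqVlt; apply/orP; left; apply/eqP; field; rewrite !gt_eqF.
lra.
Qed.

Lemma energy_ge1 eps h : 0 < eps -> tame q eps h -> 0 < density h -> 1 <= energy h.
Proof.
move=> e0 th h0; have := temperature_gt0 e0 th h0.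
have := bracket_ge1 (velocity h); rewrite /energy; lra.
Qed.

(** [mass_tail] with [sg ^+ 2] half of the energy: the first term then absorbs
    half of the mass. *)
Lemma density_energy : exists2 C : R, 0 < C & forall eps h, 0 < eps ->
  tame q eps h -> 0 < density h ->
  density h <= C * eps * energy h `^ (- ((q - 3) / 2)).
Proof.
have [C C0 hC] := @mass_tail R q q5.
exists (2 * C * 2 `^ ((q - 5) / 2)); first by rewrite !mulr_gt0// powR_gt0.
move=> eps h e0 th h0.
have hn : density h != 0 by rewrite gt_eqF.
have K1 := energy_ge1 e0 th h0; set K := energy h in K1 *.
have K0 : 0 < K by lra.
have K20 : 0 < K / 2 by lra.
pose sg := (K / 2) `^ (2^-1).
have sg0 : 0 < sg by rewrite powR_gt0.
have := hC eps h sg e0 th sg0.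
have -> : sg ^+ 2 = K / 2.
  by rewrite -powR_mulrn ?(ltW sg0)// -powRrM mulVf// powRr1 ?ltW.
rewrite (mass_energy th hn) -/K => le1.
have {}le1 : density h * K <= 2 * C * eps * sg `^ (5 - q) by lra.
rewrite -(ler_pM2r K0); apply: (le_trans le1).
have -> : sg `^ (5 - q) = K `^ (- ((q - 3) / 2)) * K * 2 `^ ((q - 5) / 2).
  rewrite -powRrM powRM ?invr_ge0 ?(ltW K0)//.
  have -> : 2^-1 * (5 - q) = - ((q - 5) / 2) by field.
  rewrite powRV//; congr (_ * _).
  have KE1 : K = K `^ 1 by rewrite powRr1// ltW.
  rewrite [X in _ = _ * X]KE1 -powR_add//.
  by congr (_ `^ _); field.
by rewrite le_eqVlt; apply/orP; left; apply/eqP; ring.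
Qed.

(** When the temperature is a small fraction of the energy, at least half of
    the particles sit in a ball around [U] on which the bracket is comparable to
    the energy, so the pointwise bound there gains the full weight [K^(-q/2)]. *)
Lemma density_cold : exists2 C : R, 0 < C & forall eps h, 0 < eps ->
  tame q eps h -> 0 < density h -> 30 * temperature h <= energy h ->
  density h <= C * eps * energy h `^ (- (q / 2)) * temperature h `^ (3 / 2).
Proof.
have [C C0 hC] := @density_concentration R q q5.
exists (2 * C * 4 `^ (q / 2) * 6 `^ (3 / 2)); first by rewrite !mulr_gt0// powR_gt0.
move=> eps h e0 th h0 cold.
have hn : density h != 0 by rewrite gt_eqF.
have K1 := energy_ge1 e0 th h0; have T0 := temperature_gt0 e0 th h0.
have KE : energy h = bracket (velocity h) + 3 * temperature h by [].
move: (energy h) (temperature h) (velocity h) KE K1 T0 cold (central_moment th hn).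
move=> K T u KE K1 T0 cold cm.
(* with [sg ^+ 2 = 6 T] at most half of the particles are outside the ball *)
have T60 : 0 < 6 * T by lra.
pose sg := (6 * T) `^ (2^-1).
have sg0 : 0 < sg by rewrite powR_gt0.
have s2 : sg ^+ 2 = 6 * T.
  by rewrite -powR_mulrn ?(ltW sg0)// -powRrM mulVf// powRr1 ?ltW.
have s3 : sg ^+ 3 = 6 `^ (3 / 2) * T `^ (3 / 2).
  rewrite -powR_mulrn ?(ltW sg0)// -powRrM -powRM//; last lra.
  by congr (_ `^ _); field.
have q20 : 0 <= q / 2 by move: q5; lra.
have K40 : 0 < K / 4 by lra.
have := hC eps h u sg (eps * (K / 4) `^ (- (q / 2))) th sg0.
rewrite cm s2 s3.
have -> : 3 * (density h * T) / (6 * T) = density h / 2.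
  by field; rewrite gt_eqF.
have -> : (K / 4) `^ (- (q / 2)) = K `^ (- (q / 2)) * 4 `^ (q / 2).
  by rewrite powRM ?invr_ge0//; [rewrite powRV|lra].
set A := K `^ _; set B := 4 `^ _; set D := 6 `^ _; set E := T `^ _.
have M0 : 0 <= eps * (A * B) by rewrite mulr_ge0 ?(ltW e0)// mulr_ge0 ?powR_ge0.
move=> /(_ M0) hle.
have : density h <= C * (eps * (A * B)) * (D * E) + density h / 2.
  apply: hle => v vs; have [_ /(_ v)/andP[_ he]] := th; apply: (le_trans he).
  rewrite ler_wpM2l ?(ltW e0)//.
  have -> : A * B = (K / 4) `^ (- (q / 2)).
    by rewrite powRM ?invr_ge0//; [rewrite powRV|lra].
  apply: ler_powRN => //.
  move: vs cold; rewrite KE sqnormBE /bracket /sqnorm/= => vs cold.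
  (* these squares give [|u|^2 <= 2 |v|^2 + 2 |v - u|^2] *)
  have := sqr_ge0 (2 * v.1.1 - u.1.1); have := sqr_ge0 (2 * v.1.2 - u.1.2).
  have := sqr_ge0 (2 * v.2 - u.2); lra.
lra.
Qed.

End moment_bounds.

(** * The stiffness bound *)

Section stiffness.
Context {R : realType}.
Implicit Types (h k : R3 R -> R) (a u v : R3 R) (eps sg : R).
Variables alpha beta q : R.
Hypotheses (alpha0 : 0 < alpha) (beta1 : beta <= 1)
  (alpha_beta : 2 <= 3 * alpha + 2 * beta) (q5 : 5 < q)
  (alpha_q : 2 * (1 + beta) <= alpha * (q - 3)).

(** The factor that converts [rho T] into the weighted size [flux] of the
    collision terms, see [flux_stiffness]. *)
Definition stiffness h : R :=
  density h `^ alpha * temperature h `^ (beta - 1) * energy h ^+ 2.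

(** For [30 T <= K] use [density_cold]: the powers of [T] combine to
    [3 alpha / 2 + beta - 1 >= 0] and may be replaced by powers of [K].
    Otherwise [T] is comparable to [K] and [density_energy] suffices. Both ways
    [K] ends with the exponent [1 + beta - alpha (q - 3) / 2 <= 0]. *)
Lemma stiffness_le : exists2 C : R, 0 < C & forall eps h, 0 < eps ->
  tame q eps h -> 0 < density h -> stiffness h <= C * eps `^ alpha.
Proof.
have [C1 C10 hC1] := @density_energy R q q5.
have [C2 C20 hC2] := @density_cold R q q5.
exists (C1 `^ alpha * 30 `^ (1 - beta) + C2 `^ alpha).
  by rewrite addr_gt0 ?mulr_gt0 ?powR_gt0.
move=> eps h e0 th h0; rewrite /stiffness.
have := hC1 eps h e0 th h0; have := hC2 eps h e0 th h0.
have := energy_ge1 q5 e0 th h0; have T0 := temperature_gt0 q5 e0 th h0.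
have : temperature h <= energy h.
  by rewrite /energy; have := bracket_ge1 (velocity h); lra.
move: (energy h) (temperature h) (density h) h0 T0 => K T r r0 T0 TK K1 cold hot.
have K0 : 0 < K by lra.
have eal : 0 <= eps `^ alpha by exact: powR_ge0.
have Kneg s : s <= 0 -> K `^ s <= 1.
  by move=> s0; rewrite -[leRHS](powRr0 K) ler_powR.
have K2 : K ^+ 2 = K `^ 2 by rewrite powR_mulrn// ltW.
have mono x y : 0 < x -> x <= y -> x `^ alpha <= y `^ alpha.
  move=> x0 xy; apply: ge0_ler_powR => //; rewrite ?nnegrE.
  - exact: ltW.
  - exact: ltW.
  - by rewrite ltW// (lt_le_trans x0).
have [cd|ht] := leP (30 * T) K.
- apply: (@le_trans _ _ (C2 `^ alpha * eps `^ alpha)); last first.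
    by rewrite mulrDl lerDr mulr_ge0// mulr_ge0// powR_ge0.
  have := mono _ _ r0 (cold cd).
  rewrite !powRM ?mulr_ge0 ?powR_ge0 ?(ltW C20) ?(ltW e0)// -!powRrM => rle.
  have Tb0 : 0 <= T `^ (beta - 1) by exact: powR_ge0.
  have TTK : T `^ (3 / 2 * alpha) * T `^ (beta - 1) <= K `^ (3 / 2 * alpha + (beta - 1)).
    rewrite -powR_add//; apply: ge0_ler_powR; rewrite ?nnegrE ?(ltW K0) ?(ltW T0)//.
    by move: alpha_beta; lra.
  apply: (le_trans (ler_wpM2r (sqr_ge0 K) (ler_wpM2r Tb0 rle))).
  set c := C2 `^ alpha * eps `^ alpha.
  have c0 : 0 <= c by rewrite mulr_ge0 ?powR_ge0.
  set A := K `^ _; set B := T `^ _ in TTK *; set D := T `^ _ in TTK *.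
  have -> : c * A * B * D * K ^+ 2 = c * (A * (B * D) * K ^+ 2) by ring.
  rewrite -[leRHS]mulr1 ler_wpM2l//.
  have A0 : 0 <= A by exact: powR_ge0.
  apply: (le_trans (ler_wpM2r (sqr_ge0 K) (ler_wpM2l A0 TTK))).
  rewrite K2 -!powR_add//; apply: Kneg.
  by move: alpha_q; lra.
- apply: (@le_trans _ _ (C1 `^ alpha * 30 `^ (1 - beta) * eps `^ alpha)); last first.
    by rewrite mulrDl lerDl mulr_ge0// powR_ge0.
  have := mono _ _ r0 hot.
  rewrite !powRM ?mulr_ge0 ?powR_ge0 ?(ltW C10) ?(ltW e0)// -!powRrM => rle.
  have TbK : T `^ (beta - 1) <= 30 `^ (1 - beta) * K `^ (beta - 1).
    have -> : beta - 1 = - (1 - beta) by ring.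
    rewrite -(powRV (1 - beta) (ler0n R 30)) -powRM ?invr_ge0 ?ler0n ?(ltW K0)//.
    apply: ler_powRN; first (by move: beta1; lra); lra.
  rewrite (le_trans (ler_wpM2r (sqr_ge0 K) (ler_pM (powR_ge0 _ _) (powR_ge0 _ _) rle TbK)))//.
  set c := C1 `^ alpha; set e := eps `^ alpha; set d := 30 `^ _.
  set A := K `^ _; set B := K `^ _.
  have -> : c * e * A * (d * B) * K ^+ 2 = c * d * e * (A * B * K ^+ 2) by ring.
  rewrite -[leRHS]mulr1 ler_wpM2l ?mulr_ge0 ?powR_ge0//.
  rewrite K2 -!powR_add//; apply: Kneg.
  by move: alpha_q; lra.
Qed.

End stiffness.

(** * Two states are close or one is negligible *)

Section closeness.
Context {R : realType}.
Implicit Types (u v e f : R3 R).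

Lemma sqnormD_parallelogram u e : sqnorm (u + e) + sqnorm (u - e)
  = 2 * sqnorm u + 2 * sqnorm e.
Proof. by rewrite sqnormBE /sqnorm/=; ring. Qed.

(** A displacement measured in units of the thermal speed [sqrt T]; the zero
    displacement is included, with an arbitrary direction. *)
Lemma direction_exists e (T : R) : 0 < T ->
  exists kf : R * R3 R, [/\ 0 <= kf.1, e = kf.1 *: kf.2 & sqnorm kf.2 = T].
Proof.
move=> T0; have [e0|en] := eqVneq (sqnorm e) 0.
  exists (0, (Num.sqrt T, 0, 0)); split => //=.
    move: e0; rewrite scale0r /sqnorm => /eqP.
    rewrite paddr_eq0 ?addr_ge0 ?sqr_ge0// paddr_eq0 ?sqr_ge0// !sqrf_eq0.
    by case: e => -[a b] c /= /andP[/andP[/eqP-> /eqP->] /eqP->].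
  by rewrite /sqnorm/= sqr_sqrtr ?ltW// expr0n/= !addr0.
have ep : 0 < sqnorm e by rewrite lt_def en sqnorm_ge0.
pose k := Num.sqrt (sqnorm e / T).
have k0 : 0 < k by rewrite sqrtr_gt0 divr_gt0.
have k2 : k ^+ 2 = sqnorm e / T by rewrite sqr_sqrtr// divr_ge0 ?sqnorm_ge0 ?ltW.
exists (k, k^-1 *: e); split => /=; first exact: ltW.
  by rewrite scalerA divff ?scale1r// gt_eqF.
have -> : sqnorm (k^-1 *: e) = (k ^+ 2)^-1 * sqnorm e.
  by rewrite /sqnorm/= /GRing.scale/=; field; rewrite gt_eqF.
by rewrite k2; field; rewrite en gt_eqF.
Qed.

(** The shift of the bulk velocity is recorded as [k *: f] with [f] of thermal
    length, so that [k] is the relative variation of the velocity. *)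
Definition close (r1 T1 : R) u1 (r2 T2 : R) u2 (k : R) f : Prop :=
  [/\ r1 / 2 <= r2 <= 2 * r1, T1 / 4 <= T2 <= 4 * T1, 0 <= k <= 1 / 4,
      u2 - u1 = k *: f & sqnorm f = T1].

(** Whenever one of the ratios is far from one, or the shift is not small, the
    moment inequalities themselves force the pressure [r1 * T1] of the first
    state below a multiple of [K * dlt]; otherwise they bound the relative
    variations. *)
Lemma small_or_close (r1 T1 r2 T2 dlt : R) (u1 u2 : R3 R) :
  0 < r1 -> 0 < T1 -> 0 < r2 -> 0 < T2 -> 0 <= dlt ->
  `|r1 - r2| <= dlt ->
  (forall u, `|r1 * (3 * T1 + sqnorm (u1 - u)) - r2 * (3 * T2 + sqnorm (u2 - u))|
     <= 2 * bracket u * dlt) ->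
  let K := bracket u1 + 3 * T1 in
  r1 * T1 <= 8 * K * dlt \/
  exists k f, close r1 T1 u1 r2 T2 u2 k f /\
    r1 * T1 * (`|r2 - r1| / r1 + `|T2 - T1| / T1 + k) <= 5 * K * dlt.
Proof.
move=> r10 T10 r20 T20 d0 rd Hu K.
have [[k f] [/= k0 ef fT]] := direction_exists (u2 - u1) T10.
have b1 := bracket_ge1 u1.
have KE : K = bracket u1 + 3 * T1 by [].
have Kd : 3 * T1 * dlt + dlt <= K * dlt.
  by rewrite -{2}(mul1r dlt) -mulrDl ler_wpM2r// KE; lra.
have z0 : sqnorm (u1 - u1) = 0 by rewrite subrr /sqnorm/= expr0n/= !addr0.
have n2 : sqnorm (u2 - u1) = k ^+ 2 * T1.
  by rewrite ef -fT /sqnorm/= /GRing.scale/=; ring.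
(* testing the second moments around [u1] compares the temperatures *)
have HT : `|3 * (r1 * T1) - 3 * (r2 * T2) - r2 * (k ^+ 2 * T1)| <= 2 * K * dlt.
  have := Hu u1; rewrite z0 n2.
  have -> : r1 * (3 * T1 + 0) - r2 * (3 * T2 + k ^+ 2 * T1) =
    3 * (r1 * T1) - 3 * (r2 * T2) - r2 * (k ^+ 2 * T1) by ring.
  move=> /le_trans; apply; rewrite ler_wpM2r// ler_wpM2l// KE; lra.
(* testing around [u1 + f] and [u1 - f] isolates the velocity shift *)
have HU : r2 * T1 * k <= K * dlt.
  have := Hu (u1 + f); have := Hu (u1 - f).
  have m1 : sqnorm (u1 - (u1 + f)) = T1.
    by rewrite opprD addrA subrr sub0r -fT /sqnorm/=; ring.
  have m2 : sqnorm (u1 - (u1 - f)) = T1 by rewrite opprB addrC subrK.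
  have p1 : sqnorm (u2 - (u1 + f)) = (k - 1) ^+ 2 * T1.
    by rewrite opprD addrA ef -fT /sqnorm/= /GRing.scale/=; ring.
  have p2 : sqnorm (u2 - (u1 - f)) = (k + 1) ^+ 2 * T1.
    by rewrite opprB addrCA addrC ef -fT /sqnorm/= /GRing.scale/=; ring.
  rewrite m1 m2 p1 p2 !ler_norml => /andP[A1 A2] /andP[A3 A4].
  have P : bracket (u1 + f) + bracket (u1 - f) = 2 * bracket u1 + 2 * T1.
    by rewrite /bracket -fT; have := sqnormD_parallelogram u1 f; lra.
  have : 2 * bracket (u1 + f) * dlt + 2 * bracket (u1 - f) * dlt <= 4 * K * dlt.
    rewrite -mulrDl ler_wpM2r// KE; lra.
  move: A1 A2 A3 A4; clear; lra.
move: (K) Kd HT HU b1 KE => L Kd HT HU b1 KE.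
have T1d : 0 <= T1 * dlt by rewrite mulr_ge0// ltW.
have rT : 0 < r1 * T1 by rewrite mulr_gt0.
have [r_lo|r_lo] := ltP r2 (r1 / 2).
  left; move: rd; rewrite ler_norml => /andP[_ rd].
  have : r1 * T1 <= 2 * dlt * T1 by rewrite ler_wpM2r ?(ltW T10)//; lra.
  lra.
have [r_hi|r_hi] := ltP (2 * r1) r2.
  left; move: rd; rewrite ler_norml => /andP[rd _].
  have : r1 * T1 <= dlt * T1 by rewrite ler_wpM2r ?(ltW T10)//; lra.
  lra.
have r2T_hi : r2 * T1 <= 2 * (r1 * T1) by rewrite mulrA ler_wpM2r// ltW.
have r2T_lo : r1 * T1 <= 2 * (r2 * T1).
  by rewrite mulrA ler_wpM2r ?(ltW T10)//; lra.
have [k_hi|k_lo] := ltP (1 / 4) k.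
  left; have : r2 * T1 * (1 / 4) <= r2 * T1 * k.
    by rewrite ler_wpM2l ?mulr_ge0 ?ltW//.
  lra.
have r2Tk : r2 * (k ^+ 2 * T1) <= 1 / 4 * (r2 * T1 * k).
  have -> : r2 * (k ^+ 2 * T1) = k * (r2 * T1 * k) by ring.
  by rewrite ler_wpM2r// !mulr_ge0// ltW.
have r2Tk' : r2 * T1 * k <= 1 / 4 * (r2 * T1).
  by rewrite mulrC ler_wpM2r// mulr_ge0 ?ltW.
have r2Tk0 : 0 <= r2 * (k ^+ 2 * T1).
  by rewrite mulr_ge0 ?(ltW r20)// mulr_ge0 ?sqr_ge0 ?(ltW T10).
have [T_lo|T_lo] := ltP T2 (T1 / 4).
  left; move: HT; rewrite ler_norml => /andP[_ HT].
  have : r2 * T2 <= r2 * (T1 / 4) by rewrite ler_wpM2l ?ltW.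
  lra.
have [T_hi|T_hi] := ltP (4 * T1) T2.
  left; move: HT; rewrite ler_norml => /andP[HT _].
  have : r2 * (4 * T1) <= r2 * T2 by rewrite ler_wpM2l ?ltW.
  lra.
right; exists k, f; split.
  by split => //; apply/andP; split.
have -> : r1 * T1 * (`|r2 - r1| / r1 + `|T2 - T1| / T1 + k) =
    T1 * `|r2 - r1| + r1 * `|T2 - T1| + r1 * T1 * k.
  by field; rewrite !gt_eqF.
have c1 : T1 * `|r2 - r1| <= T1 * dlt by rewrite ler_wpM2l ?(ltW T10)// distrC.
have c3 : r1 * T1 * k <= 2 * (r2 * T1 * k).
  by rewrite mulrA ler_wpM2r//; lra.
have c2 : 3 * (r1 * `|T2 - T1|) <= 2 * L * dlt + 12 * (T1 * dlt) + 1 / 4 * (r2 * T1 * k).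
  have E : 3 * (r1 * `|T2 - T1|) =
     `|(3 * (r1 * T1) - 3 * (r2 * T2) - r2 * (k ^+ 2 * T1))
       + 3 * ((r2 - r1) * T2) + r2 * (k ^+ 2 * T1)|.
    rewrite (_ : _ + _ + _ = 3 * r1 * (T1 - T2)); last by ring.
    by rewrite normrM distrC ger0_norm ?mulrA// mulr_ge0// ltW.
  rewrite E (le_trans (ler_normD _ _))// lerD//.
    rewrite (le_trans (ler_normD _ _))// lerD//.
    rewrite !normrM (gtr0_norm T20) ger0_norm//.
    have : `|r2 - r1| * T2 <= dlt * (4 * T1).
      by apply: ler_pM => //; [exact: ltW|rewrite distrC].
    lra.
  by rewrite ger0_norm.
lra.
Qed.

End closeness.

(** * Powers and Gaussians of comparable states *)

Section real_estimates.
Context {R : realType}.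
Implicit Types (u v e f : R3 R).

(** From [1 + x <= expR x], without the mean value theorem. *)
Lemma expR_dist_le (x y m : R) : m <= x -> m <= y ->
  `|expR (- x) - expR (- y)| <= `|x - y| * expR (- m).
Proof.
wlog xy : x y / x <= y.
  by move=> H mx my; have [/H->//|/ltW/H] := leP x y; rewrite distrC (distrC x); apply.
move=> mx my.
have exy : expR (- y) <= expR (- x) by rewrite ler_expR lerN2.
rewrite ger0_norm ?subr_ge0// distrC ger0_norm ?subr_ge0//.
have -> : expR (- y) = expR (- x) * expR (x - y) by rewrite -expRD addrA addNr add0r.
have := expR_ge1Dx (x - y) => h1.
have e0 := expR_gt0 (- x).
apply: (@le_trans _ _ ((y - x) * expR (- x))).
  rewrite -{1}(mulr1 (expR (- x))) -mulrBr mulrC ler_wpM2r ?(ltW e0)//; lra.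
by rewrite ler_wpM2l ?subr_ge0// ler_expR lerN2.
Qed.

(** Through the logarithm of [y / x], whose absolute value is at most
    [4 * |y / x - 1| <= 12] when the ratio is between [1/4] and [4]. *)
Lemma powR_ratio_lipschitz (g : R) : exists2 C : R, 0 < C & forall x y : R, 0 < x ->
  x / 4 <= y <= 4 * x -> `|y `^ g - x `^ g| <= C * x `^ g * (`|y - x| / x).
Proof.
exists (4 * (1 + `|g|) * expR (12 * `|g|)).
  by rewrite !mulr_gt0 ?expR_gt0// ltr_pwDl.
move=> x y x0 /andP[ylo yhi].
have y0 : 0 < y by rewrite (lt_le_trans _ ylo)// divr_gt0.
pose t := y / x; have t0 : 0 < t by rewrite divr_gt0.
have yE : y = t * x by rewrite /t divfK// gt_eqF.
have tlo : 1 / 4 <= t by rewrite /t ler_pdivlMr//; lra.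
have thi : t <= 4 by rewrite /t ler_pdivrMr.
have nt : `|y - x| / x = `|t - 1|.
  have -> : t - 1 = (y - x) / x by rewrite /t; field; rewrite gt_eqF.
  by rewrite normrM normfV (gtr0_norm x0).
rewrite nt yE powRM ?(ltW t0) ?(ltW x0)//.
rewrite -[X in _ * _ - X]mul1r -mulrBl normrM (ger0_norm (powR_ge0 _ _)).
rewrite [leRHS]mulrAC ler_wpM2r ?powR_ge0//.
have lnt : `|ln t| <= 4 * `|t - 1|.
  have h1 := @le_ln1Dx R (t - 1); have h2 := @le_ln1Dx R (t^-1 - 1).
  have ti0 : 0 < t^-1 by rewrite invr_gt0.
  have {}h1 : ln t <= t - 1.
    by have := h1; rewrite addrCA subrr addr0; apply; lra.
  have {}h2 : - ln t <= t^-1 - 1.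
    by rewrite -lnV ?posrE//; have := h2; rewrite addrCA subrr addr0; apply; lra.
  have ti : t^-1 - 1 <= 4 * `|t - 1|.
    have -> : t^-1 - 1 = t^-1 * (1 - t) by field; rewrite gt_eqF.
    have t4 : t^-1 <= 4.
      by rewrite -[leRHS]invrK lef_pV2 ?posrE ?invr_gt0//; lra.
    rewrite -normrN opprB (le_trans (ler_norm _))// normrM ger0_norm ?(ltW ti0)//.
    by rewrite ler_wpM2r.
  have := ler_norm (t - 1); rewrite ler_norml; have := normr_ge0 (t - 1); lra.
have lnt12 : `|ln t| <= 12.
  apply: (le_trans lnt); suff : `|t - 1| <= 3 by lra.
  by rewrite ler_norml; lra.
rewrite /powR gt_eqF//.
have := @expR_dist_le (- (g * ln t)) 0 (- (12 * `|g|)).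
rewrite opprK oppr0 expR0 addr0 opprK normrN normrM => H.
have gl : `|g| * `|ln t| <= 12 * `|g| by rewrite mulrC ler_wpM2r.
apply: (le_trans (H _ _)).
- rewrite lerN2 (le_trans (ler_norm _))// normrM//.
- by rewrite oppr_le0 mulr_ge0.
rewrite [leRHS]mulrAC ler_wpM2r ?expR_ge0//.
apply: (le_trans (ler_wpM2l (normr_ge0 g) lnt)).
have := normr_ge0 (t - 1); have := normr_ge0 g => g0 n0; nra.
Qed.

Lemma powR2_ratio_lipschitz (a b : R) : exists2 C : R, 0 < C &
  forall r1 T1 r2 T2 : R, 0 < r1 -> 0 < T1 ->
  r1 / 4 <= r2 <= 4 * r1 -> T1 / 4 <= T2 <= 4 * T1 ->
  `|r2 `^ a * T2 `^ b - r1 `^ a * T1 `^ b|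
    <= C * (r1 `^ a * T1 `^ b) * (`|r2 - r1| / r1 + `|T2 - T1| / T1).
Proof.
have [A A0 hA] := powR_ratio_lipschitz a; have [B B0 hB] := powR_ratio_lipschitz b.
exists (A + B + 3 * A * B); first by rewrite !addr_gt0// !mulr_gt0.
move=> r1 T1 r2 T2 r10 T10 rr TT.
have := hA _ _ r10 rr; have := hB _ _ T10 TT.
have x0 : 0 <= `|r2 - r1| / r1 by rewrite divr_ge0// ltW.
have y0 : 0 <= `|T2 - T1| / T1 by rewrite divr_ge0// ltW.
have x3 : `|r2 - r1| / r1 <= 3.
  by rewrite ler_pdivrMr// ler_norml; move: rr => /andP[]; lra.
move: (`|r2 - r1| / r1) (`|T2 - T1| / T1) x0 y0 x3 => x y x0 y0 x3.
have p0 : 0 <= r1 `^ a by exact: powR_ge0.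
have s0 : 0 <= T1 `^ b by exact: powR_ge0.
move: (r1 `^ a) (T1 `^ b) (r2 `^ a) (T2 `^ b) p0 s0 => p s p' s' p0 s0 hs hp.
have -> : p' * s' - p * s = (p' - p) * s + p * (s' - s) + (p' - p) * (s' - s) by ring.
rewrite (le_trans (ler_normD _ _))// (le_trans (lerD (ler_normD _ _) (lexx _)))//.
rewrite !normrM (ger0_norm p0) (ger0_norm s0).
have e1 : `|p' - p| * s <= A * p * x * s by rewrite ler_wpM2r.
have e2 : p * `|s' - s| <= p * (B * s * y) by rewrite ler_wpM2l.
have e3 : `|p' - p| * `|s' - s| <= A * p * x * (B * s * y) by rewrite ler_pM.
have ps : 0 <= p * s by rewrite mulr_ge0.
have AB : 0 < A * B by rewrite mulr_gt0.
have xy : A * B * (p * s) * (x * y) <= A * B * (p * s) * (3 * y).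
  have c0 : 0 <= A * B * (p * s) by apply: mulr_ge0 => //; exact: ltW.
  by rewrite ler_wpM2l// ler_wpM2r.
have u1 : 0 <= A * (p * s) * y by rewrite !mulr_ge0 ?(ltW A0).
have u2 : 0 <= B * (p * s) * x by rewrite !mulr_ge0 ?(ltW B0).
have u3 : 0 <= A * B * (p * s) * x by rewrite !mulr_ge0 ?(ltW A0) ?(ltW B0).
lra.
Qed.

(** Fourth power of [1 + s / 64 <= expR (s / 64)]. *)
Lemma expR_poly_le (s : R) : 0 <= s ->
  (1 + s) ^+ 4 * expR (- (s / 16)) <= 64 ^+ 4.
Proof.
move=> s0; have := expR_ge1Dx (s / 64).
have -> : expR (- (s / 16)) = (expR (s / 64) ^+ 4)^-1.
  by rewrite -expRM_natl -expRN; congr (expR (- _)); field.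
move=> h; rewrite ler_pdivrMr ?exprn_gt0 ?expR_gt0// -exprMn.
by rewrite ler_pXn2r// ?nnegrE ?mulr_ge0 ?expR_ge0//; lra.
Qed.

(** With [s] the squared velocity in thermal units, the two exponents are at
    least [s / 16 - 1 / 8], so the difference still has Gaussian decay, and they
    differ by at most [3 (1 + s)] times the relative variation. *)
Lemma gauss_dist (T1 T2 k s : R) u1 u2 f v :
  0 < T1 -> T1 / 4 <= T2 <= 4 * T1 -> 0 <= k <= 1 / 4 ->
  u2 - u1 = k *: f -> sqnorm f = T1 ->
  s = sqnorm (v - u1) / T1 ->
  `|expR (- (sqnorm (v - u1) / (2 * T1))) - expR (- (sqnorm (v - u2) / (2 * T2)))|
  <= 3 * expR (1 / 8) * (1 + s) * expR (- (s / 16)) * (`|T2 - T1| / T1 + k).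
Proof.
move=> T10 /andP[Tlo Thi] /andP[k0 k4] ef fT sE.
have T20 : 0 < T2 by lra.
have s0 : 0 <= s by rewrite sE divr_ge0 ?sqnorm_ge0 ?ltW.
pose x := v - u1; pose i := x.1.1 * f.1.1 + x.1.2 * f.1.2 + x.2 * f.2.
have xs : sqnorm x = s * T1 by rewrite sE divfK// gt_eqF.
have vu2 : sqnorm (v - u2) = s * T1 - 2 * k * i + k ^+ 2 * T1.
  have -> : v - u2 = x - k *: f by rewrite -ef /x opprB addrA subrK.
  by rewrite -xs -fT /i /sqnorm/= /GRing.scale/=; ring.
(* arithmetic-geometric mean: both [|x +- f|^2] are nonnegative *)
have ile : `|2 * i| <= (s + 1) * T1.
  have : sqnorm (x + f) = (s + 1) * T1 + 2 * i.
    by rewrite mulrDl mul1r -xs -fT /i /sqnorm/=; ring.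
  have : sqnorm (x - f) = (s + 1) * T1 - 2 * i.
    by rewrite mulrDl mul1r -xs -fT /i /sqnorm/=; ring.
  have := sqnorm_ge0 (x + f); have := sqnorm_ge0 (x - f).
  by rewrite ler_norml; lra.
have k2 : k ^+ 2 <= 1 / 4 * k by rewrite expr2 ler_wpM2r.
have k20 : 0 <= k ^+ 2 by exact: sqr_ge0.
rewrite -/x xs vu2.
have b1E : s * T1 / (2 * T1) = s / 2 by field; rewrite gt_eqF.
rewrite b1E; set b2 := _ / (2 * T2).
have T2i : 0 <= T2^-1 by rewrite invr_ge0 ltW.
pose t := T1 / T2.
have t4 : t <= 4 by rewrite /t ler_pdivrMr//; lra.
have tl : 1 / 4 <= t by rewrite /t ler_pdivlMr//; lra.
have b2E : b2 = t * s / 2 - k * i / T2 + k ^+ 2 * t / 2.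
  by rewrite /b2 /t; field; rewrite gt_eqF.
have iT : `|k * i / T2| <= k * (s + 1) * t / 2.
  have -> : k * i / T2 = k * (2 * i) * (T2^-1 / 2) by field; rewrite gt_eqF.
  rewrite 2!normrM (ger0_norm k0) [X in _ * X]ger0_norm; last by lra.
  have -> : k * (s + 1) * t / 2 = k * ((s + 1) * T1) * (T2^-1 / 2).
    by rewrite /t; field; rewrite gt_eqF.
  by rewrite ler_wpM2r ?ler_wpM2l//; lra.
have b2lo : s / 16 - 1 / 8 <= b2.
  have b20 : 0 <= b2 by rewrite /b2 -vu2 divr_ge0 ?sqnorm_ge0// mulr_ge0 ?ltW.
  have [sle|sgt] := leP s 2; first by lra.
  move: iT; rewrite ler_norml b2E => /andP[iT1 iT2].
  have : 0 <= k ^+ 2 * t by rewrite mulr_ge0//; lra.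
  have st : 1 / 4 * s <= t * s by rewrite ler_wpM2r.
  have : k * (s + 1) * t <= 1 / 4 * ((s + 1) * t).
    by rewrite -mulrA ler_wpM2r// mulr_ge0//; lra.
  nra.
have bd : `|s / 2 - b2| <= 3 * (1 + s) * (`|T2 - T1| / T1 + k).
  have -> : s / 2 - b2 = s / 2 * (1 - t) + (k * i / T2 - k ^+ 2 * t / 2).
    by rewrite b2E; ring.
  have tT : `|1 - t| <= 4 * (`|T2 - T1| / T1).
    have -> : 1 - t = (T2 - T1) / T1 * t by rewrite /t; field; rewrite !gt_eqF.
    rewrite 2!normrM normfV (gtr0_norm T10) (ger0_norm (le_trans _ tl))//.
    by rewrite mulrC ler_wpM2r// divr_ge0// ltW.
  rewrite (le_trans (ler_normD _ _))//.
  have y0 : 0 <= `|T2 - T1| / T1 by rewrite divr_ge0// ltW.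
  have p1 : `|s / 2 * (1 - t)| <= 2 * s * (`|T2 - T1| / T1).
    rewrite normrM ger0_norm; last lra.
    have -> : 2 * s * (`|T2 - T1| / T1) = s / 2 * (4 * (`|T2 - T1| / T1)) by field; rewrite gt_eqF.
    by rewrite ler_wpM2l//; lra.
  have p2 : `|k * i / T2 - k ^+ 2 * t / 2| <= 3 * (1 + s) * k.
    rewrite (le_trans (ler_normB _ _))//.
    have -> : `|k ^+ 2 * t / 2| = k ^+ 2 * t / 2 by rewrite ger0_norm// !mulr_ge0//; lra.
    have : k ^+ 2 * t <= 1 / 4 * k * 4 by rewrite ler_pM//; lra.
    have : k * (s + 1) * t <= k * (s + 1) * 4.
      by rewrite ler_wpM2l// mulr_ge0//; lra.
    have : 0 <= k * s by rewrite mulr_ge0.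
    lra.
  move: (`|T2 - T1| / T1) y0 p1 => y y0 p1.
  have : 0 <= s * y by rewrite mulr_ge0.
  lra.
apply: (le_trans (@expR_dist_le (s / 2) b2 (s / 16 - 1 / 8) _ b2lo)); first lra.
have -> : expR (- (s / 16 - 1 / 8)) = expR (1 / 8) * expR (- (s / 16)).
  by rewrite -expRD; congr expR; ring.
apply: (le_trans (ler_wpM2r _ bd)); first by rewrite mulr_ge0 ?expR_ge0.
by rewrite le_eqVlt; apply/orP; left; apply/eqP; ring.
Qed.

End real_estimates.

(** * The weighted norm in velocity *)

Lemma le_eq2 {d} {T : porderType d} (x y x' y' : T) :
  x = x' -> y' = y -> (x' <= y')%O -> (x <= y)%O.
Proof. by move=> -> ->. Qed.

Section velocity_norm.
Context {R : realType}.
Implicit Types (F G h k : R3 R -> R) (a u v : R3 R).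

Definition L12v F : \bar R := (\int[leb3]_v (bracket v * `|F v|)%:E)%E.

Lemma measurable_bracketM F : vmeasurable F -> vmeasurable (fun v => bracket v * `|F v|).
Proof.
move=> mF; apply: measurable_funM; first exact: measurable_bracket.
exact: measurableT_comp.
Qed.

Lemma L12v_ge0 F v : (0 <= (bracket v * `|F v|)%:E)%E.
Proof. by rewrite lee_fin mulr_ge0// ltW// bracket_gt0. Qed.

Lemma L12v_le (c : R) F G : 0 <= c -> vmeasurable F -> vmeasurable G ->
  (forall v, `|F v| <= c * `|G v|) -> (L12v F <= c%:E * L12v G)%E.
Proof.
move=> c0 mF mG FG; rewrite /L12v -ge0_integralZl//; last 2 first.
- by apply/measurable_EFinP; exact: measurable_bracketM.
- by move=> v _; exact: L12v_ge0.
apply: ge0_le_integral => //.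
- by move=> v _; exact: L12v_ge0.
- by apply/measurable_EFinP; exact: measurable_bracketM.
- apply/measurable_EFinP; apply: measurable_funM => //.
  exact: measurable_bracketM.
- move=> v _; rewrite -EFinM lee_fin mulrCA ler_wpM2l//.
  by rewrite ltW// bracket_gt0.
Qed.

Lemma L12v_le2 (c d : R) F G H : 0 <= c -> 0 <= d ->
  vmeasurable F -> vmeasurable G -> vmeasurable H ->
  (forall v, `|F v| <= c * `|G v| + d * `|H v|) ->
  (L12v F <= c%:E * L12v G + d%:E * L12v H)%E.
Proof.
move=> c0 d0 mF mG mH FGH.
have mGb := measurable_bracketM mG; have mHb := measurable_bracketM mH.
rewrite /L12v -!ge0_integralZl//; last 4 first.
- exact/measurable_EFinP.
- by move=> v _; exact: L12v_ge0.
- exact/measurable_EFinP.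
- by move=> v _; exact: L12v_ge0.
rewrite -ge0_integralD//; last 4 first.
- by move=> v _; rewrite mule_ge0 ?lee_fin//; exact: L12v_ge0.
- by apply/measurable_EFinP; exact: measurable_funM.
- by move=> v _; rewrite mule_ge0 ?lee_fin//; exact: L12v_ge0.
- by apply/measurable_EFinP; exact: measurable_funM.
apply: ge0_le_integral => //.
- by move=> v _; exact: L12v_ge0.
- by apply/measurable_EFinP; exact: measurable_bracketM.
- by apply/measurable_EFinP; apply: measurable_funD; exact: measurable_funM.
- move=> v _; rewrite -!EFinM -EFinD lee_fin.
  have -> : c * (bracket v * `|G v|) + d * (bracket v * `|H v|)
    = bracket v * (c * `|G v| + d * `|H v|) by ring.
  by rewrite ler_wpM2l// ltW// bracket_gt0.
Qed.

Lemma L12v_tame (q eps : R) h : 5 < q -> tame q eps h -> L12v h = (mass h)%:E.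
Proof.
move=> q5 th; rewrite /L12v /mass /Rintegral fineK.
  by apply: eq_integral => v _; rewrite ger0_norm// (tame_ge0 th).
apply: integrable_fin_num => //; exact: (tame_integrable_bracket q5 th).
Qed.

Lemma L12v_normr F : L12v (fun v => `|F v|) = L12v F.
Proof. by rewrite /L12v; apply: eq_integral => v _; rewrite normr_id. Qed.

Lemma bracket_shift (u v : R3 R) : bracket v <= 2 * (bracket u + sqnorm (v - u)).
Proof.
rewrite sqnormBE /bracket /sqnorm.
have := sqr_ge0 (v.1.1 - 2 * u.1.1); have := sqr_ge0 (v.1.2 - 2 * u.1.2).
have := sqr_ge0 (v.2 - 2 * u.2); lra.
Qed.

(** The weight costs one factor [K * (1 + s)]; after the polynomial factors are
    absorbed into the Gaussian, the kernel of exponent [4] at the thermal scale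
    remains, which yields [T^(3/2)]. *)
Lemma L12v_gauss : exists2 J : R, 0 < J & forall F u (T K c : R),
  vmeasurable F -> 0 < T -> bracket u + T <= K -> 0 <= c ->
  (forall s v, s = sqnorm (v - u) / T ->
     `|F v| <= c * ((1 + s) * expR (- (s / 16)))) ->
  (L12v F <= (J * (c * K * T `^ (3 / 2)))%:E)%E.
Proof.
have p3 : 3 < 4 :> R by lra.
have [J J0 hJ] := integral_bracket_le p3.
exists (2 * 64 ^+ 4 * J); first by rewrite !mulr_gt0// exprn_gt0.
move=> F u T K c mF T0 uK c0 Fle.
pose sg := T `^ (2^-1).
have sg0 : 0 < sg by rewrite powR_gt0.
have s2 : sg ^+ 2 = T.
  by rewrite -powR_mulrn ?(ltW sg0)// -powRrM mulVf// powRr1 ?ltW.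
have s3 : sg ^+ 3 = T `^ (3 / 2).
  by rewrite -powR_mulrn ?(ltW sg0)// -powRrM; congr (_ `^ _); field.
have K0 : 0 <= K by have := bracket_ge1 u; lra.
have cK : 0 <= c * K * (2 * 64 ^+ 4) by rewrite !mulr_ge0// exprn_ge0.
have -> : 2 * 64 ^+ 4 * J * (c * K * T `^ (3 / 2))
   = c * K * (2 * 64 ^+ 4) * (J * sg ^+ 3) by rewrite s3; ring.
rewrite EFinM; apply: le_trans (lee_wpmul2l _ (hJ u sg sg0)); last by rewrite lee_fin.
rewrite -ge0_integralZl//; last 2 first.
- by apply/measurable_EFinP; exact: measurable_kernel.
- by move=> v _; rewrite lee_fin powR_ge0.
apply: ge0_le_integral => //.
- by move=> v _; exact: L12v_ge0.
- by apply/measurable_EFinP; exact: measurable_bracketM.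
- apply/measurable_EFinP; apply: measurable_funM => //; exact: measurable_kernel.
move=> v _; rewrite -EFinM lee_fin s2.
have {}Fle := Fle _ v erefl.
have s0 : 0 <= sqnorm (v - u) / T by rewrite divr_ge0 ?sqnorm_ge0 ?ltW.
have bv : bracket v <= 2 * K * (1 + sqnorm (v - u) / T).
  apply: (le_trans (bracket_shift u v)).
  have : T * (sqnorm (v - u) / T) <= K * (sqnorm (v - u) / T).
    by rewrite ler_wpM2r//; have := bracket_ge1 u; lra.
  rewrite mulrCA divff ?gt_eqF// mulr1; have := T0; lra.
move: (sqnorm (v - u) / T) s0 bv Fle => s s0 bv Fle.
have s1 : 0 < 1 + s by lra.
apply: (le_trans (ler_pM (ltW (bracket_gt0 v)) (normr_ge0 _) bv Fle)).
have -> : (1 + s) `^ (- (4 / 2)) = ((1 + s) ^+ 2)^-1.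
  by rewrite powRN (_ : 4 / 2 = 2%:R) ?powR_mulrn ?(ltW s1)//; field.
rewrite ler_pdivlMr ?exprn_gt0//.
have := ler_wpM2l (mulr_ge0 (mulr_ge0 c0 K0) (ler0n R 2)) (expR_poly_le s0).
by apply: le_eq2; ring.
Qed.

End velocity_norm.

(** * From size and closeness to a Lipschitz bound *)

Section lipschitz_scheme.
Context {R : realType}.
Implicit Types (h : R3 R -> R) (u v f : R3 R) (eps : R).
Variables alpha beta q : R.
Hypotheses (alpha0 : 0 < alpha) (beta1 : beta <= 1)
  (alpha_beta : 2 <= 3 * alpha + 2 * beta) (q5 : 5 < q)
  (alpha_q : 2 * (1 + beta) <= alpha * (q - 3)).

Notation nu := (collfreq alpha beta).
Notation stiff := (stiffness alpha beta).

(** The weighted mass of the loss term, and up to a constant of the Maxwellian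
    term. *)
Definition flux h : R := nu h * (density h * energy h).

Lemma collfreqE h : 0 < density h ->
  nu h = density h `^ alpha * temperature h `^ beta.
Proof. by move=> h0; rewrite /collfreq gt_eqF. Qed.

Lemma collfreq_ge0 h : 0 <= nu h.
Proof. by rewrite /collfreq; case: ifP => // _; rewrite mulr_ge0 ?powR_ge0. Qed.

Lemma flux_stiffness eps h : 0 < eps -> tame q eps h -> 0 < density h ->
  flux h * energy h = stiff h * (density h * temperature h).
Proof.
move=> e0 th h0; have T0 := temperature_gt0 q5 e0 th h0.
rewrite /flux /stiffness collfreqE//.
have -> : temperature h `^ beta = temperature h `^ (beta - 1) * temperature h.
  have TE : temperature h = temperature h `^ 1 by rewrite powRr1 ?ltW.
  by rewrite [X in _ = _ * X]TE -powR_add// subrK.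
by ring.
Qed.

Lemma stiffness_ge0 h : 0 <= stiff h.
Proof. by rewrite /stiffness mulr_ge0 ?sqr_ge0// mulr_ge0 ?powR_ge0. Qed.

Lemma collfreq_le_stiffness eps h : 0 < eps -> tame q eps h -> nu h <= stiff h.
Proof.
move=> e0 th; have := density_ge0 th; rewrite le_eqVlt => /predU1P[h0|h0].
  by rewrite /collfreq -h0 eqxx stiffness_ge0.
have T0 := temperature_gt0 q5 e0 th h0; have K1 := energy_ge1 q5 e0 th h0.
have TK : temperature h <= energy h.
  by rewrite /energy; have := bracket_ge1 (velocity h); lra.
have fs := flux_stiffness e0 th h0; move: fs; rewrite /flux => fs.
have K2 : 0 < density h * energy h ^+ 2 by rewrite mulr_gt0// exprn_gt0//; lra.
rewrite -(ler_pM2r K2).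
have -> : nu h * (density h * energy h ^+ 2) = nu h * (density h * energy h) * energy h by ring.
rewrite fs ler_wpM2l ?stiffness_ge0// ler_wpM2l ?(ltW h0)//.
by rewrite expr2; nra.
Qed.

Variable G : (R3 R -> R) -> R3 R -> R.
Hypothesis G_measurable : forall eps h, tame q eps h -> vmeasurable (G h).
Hypothesis G_vacuum : forall h, density h = 0 -> forall v, G h v = 0.
Hypothesis G_size : exists2 C : R, 0 < C & forall eps h, 0 < eps ->
  tame q eps h -> 0 < density h -> (L12v (G h) <= (C * flux h)%:E)%E.
Hypothesis G_close : exists2 C : R, 0 < C & forall eps h1 h2 k f, 0 < eps ->
  tame q eps h1 -> tame q eps h2 -> 0 < density h1 -> 0 < density h2 ->
  close (density h1) (temperature h1) (velocity h1)
        (density h2) (temperature h2) (velocity h2) k f ->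
  (L12v (fun v => (G h1 v - G h2 v)%R) <=
   (C * (flux h1 * (`|density h2 - density h1| / density h1
       + `|temperature h2 - temperature h1| / temperature h1 + k)
       + nu h2 * mass (fun v => `|h1 v - h2 v|)))%:E)%E.

(** Apply [small_or_close] to both orders of the two states. If it gives
    closeness once, [G_close] concludes; otherwise both pressures are small and
    the triangle inequality with [G_size] is enough. Vacuum counts as small
    pressure, which is why [G_vacuum] is required. *)
Lemma lipschitz_scheme : exists2 C : R, 0 < C & forall eps h1 h2, 0 < eps ->
  tame q eps h1 -> tame q eps h2 ->
  (L12v (fun v => (G h1 v - G h2 v)%R) <=
   (C * eps `^ alpha * mass (fun v => `|h1 v - h2 v|))%:E)%E.
Proof.
have [S S0 hS] := stiffness_le alpha0 beta1 alpha_beta q5 alpha_q.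
have [A A0 hA] := G_size; have [B B0 hB] := G_close.
exists (16 * A * S + 6 * B * S).
  by rewrite addr_gt0// mulr_gt0// mulr_gt0.
move=> eps h1 h2 e0 t1 t2; set dlt := mass _; set e := eps `^ alpha.
have e'0 : 0 <= e by exact: powR_ge0.
have SE h : tame q eps h -> 0 < density h -> stiff h <= S * e by exact: hS.
have L12C : L12v (fun v => (G h2 v - G h1 v)%R) = L12v (fun v => (G h1 v - G h2 v)%R).
  by rewrite /L12v; apply: eq_integral => v _; rewrite distrC.
have massC : mass (fun v => `|h2 v - h1 v|) = dlt.
  by rewrite /dlt/mass; apply: eq_Rintegral => v _; rewrite distrC.
have d0 : 0 <= dlt.
  by apply: le_trans (density_dist q5 t1 t2).
have AS0 : 0 <= A * S by rewrite mulr_ge0 ?ltW.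
have BS0 : 0 <= B * S by rewrite mulr_ge0 ?ltW.
have ASd : 0 <= A * S * (e * dlt) by rewrite mulr_ge0// mulr_ge0.
have BSd : 0 <= B * S * (e * dlt) by rewrite mulr_ge0// mulr_ge0.
have small h : tame q eps h ->
    (0 < density h -> density h * temperature h <= 8 * energy h * dlt) ->
    (L12v (G h) <= (8 * A * S * (e * dlt))%:E)%E.
  move=> th hd; have := density_ge0 th; rewrite le_eqVlt => /predU1P[h0|h0].
    rewrite /L12v integral0_eq.
      by rewrite lee_fin; have := ASd; lra.
    by move=> v _; rewrite G_vacuum// normr0 mulr0.
  apply: (le_trans (hA eps h e0 th h0)); rewrite lee_fin.
  have K0 : 0 < energy h by have := energy_ge1 q5 e0 th h0; lra.
  have -> : 8 * A * S * (e * dlt) = A * (8 * (S * e) * dlt) by ring.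
  rewrite ler_wpM2l ?(ltW A0)// -(ler_pM2r K0) (flux_stiffness e0 th h0).
  apply: (le_trans (ler_pM (stiffness_ge0 h) _ (SE h th h0) (hd h0))).
    by rewrite mulr_ge0 ?ltW// (temperature_gt0 q5 e0 th).
  by rewrite le_eqVlt; apply/orP; left; apply/eqP; ring.
have closeb ha hb : tame q eps ha -> tame q eps hb ->
    0 < density ha -> 0 < density hb -> mass (fun v => `|ha v - hb v|) = dlt ->
    (forall k f, close (density ha) (temperature ha) (velocity ha)
        (density hb) (temperature hb) (velocity hb) k f ->
      density ha * temperature ha * (`|density hb - density ha| / density ha
       + `|temperature hb - temperature ha| / temperature ha + k)
        <= 5 * energy ha * dlt ->
    (L12v (fun v => (G ha v - G hb v)%R) <= ((16 * A * S + 6 * B * S) * e * dlt)%:E)%E).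
  move=> ta tb a0 b0 mE k f cl hk.
  apply: (le_trans (hB eps ha hb k f e0 ta tb a0 b0 cl)); rewrite mE lee_fin.
  set D := (_ + _ + k) in hk *.
  have K0 : 0 < energy ha by have := energy_ge1 q5 e0 ta a0; lra.
  have fD : flux ha * D <= 5 * (S * e) * dlt.
    rewrite -(ler_pM2r K0) mulrAC (flux_stiffness e0 ta a0) -[leLHS]mulrA.
    apply: (le_trans (ler_wpM2l (stiffness_ge0 ha) hk)).
    have -> : 5 * (S * e) * dlt * energy ha = S * e * (5 * energy ha * dlt) by ring.
    by rewrite ler_wpM2r ?SE// !mulr_ge0// ltW.
  have nd : nu hb * dlt <= S * e * dlt.
    by rewrite ler_wpM2r// (le_trans (collfreq_le_stiffness e0 tb))// SE.
  have : B * (flux ha * D + nu hb * dlt) <= B * (6 * (S * e) * dlt).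
    by rewrite ler_wpM2l ?(ltW B0)//; lra.
  lra.
have alt ha hb : tame q eps ha -> tame q eps hb ->
    mass (fun v => `|ha v - hb v|) = dlt ->
    (0 < density ha -> density ha * temperature ha <= 8 * energy ha * dlt) \/
    (L12v (fun v => (G ha v - G hb v)%R) <= ((16 * A * S + 6 * B * S) * e * dlt)%:E)%E.
  move=> ta tb mE.
  have := density_ge0 ta; rewrite le_eqVlt => /predU1P[a0|a0].
    by left; rewrite -a0 ltxx.
  have Ta := temperature_gt0 q5 e0 ta a0; have K1 := energy_ge1 q5 e0 ta a0.
  have dd := density_dist q5 ta tb; rewrite mE in dd.
  have := density_ge0 tb; rewrite le_eqVlt => /predU1P[b0|b0].
    left => _; rewrite -b0 subr0 gtr0_norm// in dd.
    have TK : temperature ha <= energy ha.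
      by rewrite /energy; have := bracket_ge1 (velocity ha); lra.
    have := ler_pM (ltW a0) (ltW Ta) dd TK.
    have : 0 <= dlt * energy ha by rewrite mulr_ge0//; lra.
    lra.
  have Tb := temperature_gt0 q5 e0 tb b0.
  have := @small_or_close R (density ha) (temperature ha) (density hb)
    (temperature hb) dlt (velocity ha) (velocity hb) a0 Ta b0 Tb d0 dd.
  rewrite -/(energy ha); case=> [u|sm|[k [f [cl hk]]]].
  - rewrite -(second_moment q5 ta) ?gt_eqF// -(second_moment q5 tb) ?gt_eqF//.
    by rewrite -mE; exact: (second_moment_dist q5 ta tb).
  - by left => _; exact: sm.
  - by right; exact: (closeb ha hb ta tb a0 b0 mE k f cl hk).
have [s1|//] := alt h1 h2 t1 t2 erefl.
have [s2|] := alt h2 h1 t2 t1 massC; last by rewrite L12C.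
apply: (@le_trans _ _ (1%:E * L12v (G h1) + 1%:E * L12v (G h2))%E).
  apply: L12v_le2 => //.
  - by apply: measurable_funB; [exact: (G_measurable t1)|exact: (G_measurable t2)].
  - exact: (G_measurable t1).
  - exact: (G_measurable t2).
  - by move=> v; rewrite !mul1r ler_normB.
rewrite !mul1e; apply: (le_trans (leeD (small _ t1 s1) (small _ t2 s2))).
by rewrite -EFinD lee_fin; lra.
Qed.

End lipschitz_scheme.

(** * The Maxwellian and the loss term *)

Lemma loss_close_aux {R : realFieldType} (C n a b E m D : R) : 0 < C ->
  n <= C * a * D -> 0 <= a -> 0 <= b -> 0 <= E -> 0 <= m -> 0 <= D ->
  n * E + b * m <= (C + 1) * (a * E * D + b * m).
Proof.
move=> C0 nle a0 b0 E0 m0 D0; have := ler_wpM2r E0 nle.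
have : 0 <= a * E * D by rewrite !mulr_ge0.
have : 0 <= C * (b * m) by rewrite !mulr_ge0// ltW.
lra.
Qed.

Lemma product_dist_aux {R : realFieldType} (C g a1 a2 E1 E2 z k w : R) :
  0 < C -> 0 < g -> 0 <= a1 -> 0 <= a2 -> 0 <= E1 -> E1 <= w -> 0 <= k ->
  0 <= z <= 4 -> `|a2 - a1| <= C * a1 * z -> `|E1 - E2| <= g * w * (z + k) ->
  `|a1 * E1 - a2 * E2| <= a1 * (C + (1 + 4 * C) * g) * (z + k) * w.
Proof.
move=> C0 g0 a10 a20 E10 E1w k0 /andP[z0 z4] da dE.
have w0 : 0 <= w by exact: le_trans E1w.
have Ca : 0 <= C * a1 by rewrite mulr_ge0// ltW.
have a2le : a2 <= (1 + 4 * C) * a1.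
  by have := ler_wpM2l Ca z4; move: da; rewrite ler_norml; lra.
have -> : a1 * E1 - a2 * E2 = (a1 - a2) * E1 + a2 * (E1 - E2) by ring.
apply: (le_trans (ler_normD _ _)); rewrite !normrM (ger0_norm E10) (ger0_norm a20).
rewrite distrC in da.
have q1 : `|a1 - a2| * E1 <= C * a1 * (z + k) * w.
  apply: ler_pM => //; apply: (le_trans da).
  by rewrite ler_wpM2l// lerDl.
have q2 : a2 * `|E1 - E2| <= (1 + 4 * C) * a1 * (g * w * (z + k)).
  exact: ler_pM.
lra.
Qed.

Section operators.
Context {R : realType}.
Implicit Types (h : R3 R -> R) (u v f : R3 R) (eps : R).
Variables alpha beta q : R.
Hypothesis q5 : 5 < q.

Notation nu := (collfreq alpha beta).

Definition gain h v : R := nu h * maxwellian h v.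

Definition loss h v : R := nu h * h v.

Lemma loss_measurable eps h : tame q eps h -> vmeasurable (loss h).
Proof. by move=> th; apply: measurable_funM => //; exact: (tame_measurable th). Qed.

Lemma loss_vacuum h : density h = 0 -> forall v, loss h v = 0.
Proof. by move=> h0 v; rewrite /loss /collfreq h0 eqxx mul0r. Qed.

Lemma loss_size : exists2 C : R, 0 < C & forall eps h, 0 < eps ->
  tame q eps h -> 0 < density h -> (L12v (loss h) <= (C * flux alpha beta h)%:E)%E.
Proof.
exists 1 => // eps h e0 th h0; have n0 := collfreq_ge0 alpha beta h.
apply: (@le_trans _ _ ((nu h)%:E * L12v h)%E).
  apply: L12v_le => //; [exact: (loss_measurable th)|exact: (tame_measurable th)|].
  by move=> v; rewrite normrM (ger0_norm n0).
by rewrite (L12v_tame q5 th) (mass_energy q5 th) ?gt_eqF// -EFinM mul1r.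
Qed.

Lemma close_ratio (r1 T1 r2 T2 k : R) u1 u2 f : 0 < r1 ->
  close r1 T1 u1 r2 T2 u2 k f -> r1 / 4 <= r2 <= 4 * r1.
Proof. by move=> r10 [/andP[? ?] _ _ _ _]; apply/andP; split; lra. Qed.

Lemma collfreq_close : exists2 C : R, 0 < C & forall eps h1 h2 k f, 0 < eps ->
  tame q eps h1 -> tame q eps h2 -> 0 < density h1 -> 0 < density h2 ->
  close (density h1) (temperature h1) (velocity h1)
        (density h2) (temperature h2) (velocity h2) k f ->
  `|nu h1 - nu h2| <= C * nu h1 * (`|density h2 - density h1| / density h1
       + `|temperature h2 - temperature h1| / temperature h1 + k).
Proof.
have [C C0 hC] := powR2_ratio_lipschitz alpha beta.
exists C => // eps h1 h2 k f e0 t1 t2 h10 h20 cl.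
rewrite !collfreqE// distrC.
have T0 := temperature_gt0 q5 e0 t1 h10.
have rr := close_ratio h10 cl; case: cl => _ TT /andP[k0 _] _ _.
apply: (le_trans (hC _ _ _ _ h10 T0 rr TT)).
rewrite ler_wpM2l ?lerDl// mulr_ge0 ?(ltW C0)// mulr_ge0 ?powR_ge0//.
Qed.

(** Product rule: [nu1 h1 - nu2 h2 = (nu1 - nu2) h1 + nu2 (h1 - h2)]. *)
Lemma loss_close : exists2 C : R, 0 < C & forall eps h1 h2 k f, 0 < eps ->
  tame q eps h1 -> tame q eps h2 -> 0 < density h1 -> 0 < density h2 ->
  close (density h1) (temperature h1) (velocity h1)
        (density h2) (temperature h2) (velocity h2) k f ->
  (L12v (fun v => (loss h1 v - loss h2 v)%R) <=
   (C * (flux alpha beta h1 * (`|density h2 - density h1| / density h1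
       + `|temperature h2 - temperature h1| / temperature h1 + k)
       + nu h2 * mass (fun v => `|h1 v - h2 v|)))%:E)%E.
Proof.
have [C C0 hC] := collfreq_close.
exists (C + 1); first by rewrite addr_gt0.
move=> eps h1 h2 k f e0 t1 t2 h10 h20 cl.
have := hC eps h1 h2 k f e0 t1 t2 h10 h20 cl.
have T0 := temperature_gt0 q5 e0 t1 h10.
case: cl => _ _ /andP[k0 _] _ _.
have n2 := collfreq_ge0 alpha beta h2; have n1 := collfreq_ge0 alpha beta h1.
have D0 : 0 <= `|density h2 - density h1| / density h1
       + `|temperature h2 - temperature h1| / temperature h1 + k.
  by rewrite !addr_ge0// divr_ge0// ltW.
set D := (_ + _ + k) in D0 *; move=> nd; have td := tame_dist t1 t2.
apply: (@le_trans _ _ (`|nu h1 - nu h2|%:E * L12v h1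
    + (nu h2)%:E * L12v (fun v => `|h1 v - h2 v|)%R)%E).
  apply: L12v_le2 => //.
  - by apply: measurable_funB; [exact: (loss_measurable t1)|exact: (loss_measurable t2)].
  - exact: (tame_measurable t1).
  - exact: (tame_measurable td).
  - move=> v; rewrite normr_id -[X in X * `|h1 v - _|](ger0_norm n2) -!normrM.
    rewrite /loss; move: (nu h1) (nu h2) (h1 v) (h2 v) => a b c d.
    by rewrite (_ : a * c - b * d = (a - b) * c + b * (c - d)) ?ler_normD//; ring.
rewrite (L12v_tame q5 td) (L12v_tame q5 t1) (mass_energy q5 t1) ?gt_eqF//.
rewrite -!EFinM -EFinD lee_fin /flux.
have E0 : 0 <= density h1 * energy h1.
  by rewrite mulr_ge0 ?(ltW h10)// (le_trans ler01)// (energy_ge1 q5 e0 t1).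
have m0 : 0 <= mass (fun v => `|h1 v - h2 v|).
  by apply: le_trans (density_dist q5 t1 t2).
exact: (loss_close_aux C0 nd n1 n2 E0 m0 D0).
Qed.

Definition gauss_const : R := ((2 * pi) `^ (3 / 2))^-1.

Lemma gauss_const_gt0 : 0 < gauss_const.
Proof. by rewrite invr_gt0 powR_gt0// mulr_gt0// pi_gt0. Qed.

(** The collision frequency times the prefactor of the Maxwellian. *)
Definition gain_amp h : R :=
  gauss_const * (density h `^ (alpha + 1) * temperature h `^ (beta - 3 / 2)).

Lemma gain_amp_ge0 h : 0 <= gain_amp h.
Proof.
by rewrite /gain_amp mulr_ge0 ?(ltW gauss_const_gt0)// mulr_ge0 ?powR_ge0.
Qed.

Lemma gainE h v : 0 < density h -> 0 < temperature h -> gain h v =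
  gain_amp h * expR (- (sqnorm (v - velocity h) / (2 * temperature h))).
Proof.
move=> h0 T0; rewrite /gain collfreqE// /maxwellian gt_eqF// /gain_amp /gauss_const.
have p0 : 0 <= 2 * pi :> R by rewrite mulr_ge0// pi_ge0.
rewrite powRM// ?(ltW T0)// invfM powR_add// powRr1 ?(ltW h0)//.
rewrite (powR_add _ _ T0) powRN; ring.
Qed.

Lemma gain_amp_flux h : 0 < density h -> 0 < temperature h ->
  gain_amp h * energy h * temperature h `^ (3 / 2)
  = gauss_const * flux alpha beta h.
Proof.
move=> h0 T0; rewrite /flux collfreqE// /gain_amp.
rewrite powR_add// powRr1 ?(ltW h0)//.
have -> : temperature h `^ beta =
    temperature h `^ (beta - 3 / 2) * temperature h `^ (3 / 2).
  by rewrite -powR_add// subrK.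
by ring.
Qed.

Lemma gain_measurable eps h : tame q eps h -> vmeasurable (gain h).
Proof.
move=> _; apply: measurable_funM => //; rewrite /maxwellian.
have [h0|h0] := eqVneq (density h) 0; first exact: measurable_cst.
apply: measurable_funM => //; apply: measurableT_comp => //.
apply: measurableT_comp => //; apply: measurable_funM => //.
exact: measurable_sqnorm_sub.
Qed.

Lemma gain_vacuum h : density h = 0 -> forall v, gain h v = 0.
Proof. by move=> h0 v; rewrite /gain /collfreq h0 eqxx mul0r. Qed.

Lemma expR_half_le (s : R) : 0 <= s ->
  expR (- (s / 2)) <= (1 + s) * expR (- (s / 16)).
Proof.
move=> s0; apply: (@le_trans _ _ (expR (- (s / 16)))).
  by rewrite ler_expR; lra.
by rewrite ler_peMl ?expR_ge0//; lra.
Qed.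

Lemma gain_size : exists2 C : R, 0 < C & forall eps h, 0 < eps ->
  tame q eps h -> 0 < density h -> (L12v (gain h) <= (C * flux alpha beta h)%:E)%E.
Proof.
have [J J0 hJ] := @L12v_gauss R.
exists (J * gauss_const); first by rewrite mulr_gt0// gauss_const_gt0.
move=> eps h e0 th h0; have T0 := temperature_gt0 q5 e0 th h0.
rewrite -mulrA -gain_amp_flux//.
apply: (hJ _ (velocity h)) => //.
- exact: (gain_measurable th).
- by rewrite /energy; lra.
- exact: gain_amp_ge0.
move=> s v sE; rewrite gainE// normrM (ger0_norm (gain_amp_ge0 h)).
rewrite ger0_norm ?expR_ge0// ler_wpM2l ?gain_amp_ge0//.
have -> : sqnorm (v - velocity h) / (2 * temperature h) = s / 2.
  by rewrite sE; field; rewrite gt_eqF.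
by apply: expR_half_le; rewrite sE divr_ge0 ?sqnorm_ge0// ltW.
Qed.

(** Amplitudes and Gaussians vary separately ([product_dist_aux]); both
    variations are relative ones times the amplitude of the first state and a
    Gaussian around its bulk velocity, to which [L12v_gauss] applies. *)
Lemma gain_close : exists2 C : R, 0 < C & forall eps h1 h2 k f, 0 < eps ->
  tame q eps h1 -> tame q eps h2 -> 0 < density h1 -> 0 < density h2 ->
  close (density h1) (temperature h1) (velocity h1)
        (density h2) (temperature h2) (velocity h2) k f ->
  (L12v (fun v => (gain h1 v - gain h2 v)%R) <=
   (C * (flux alpha beta h1 * (`|density h2 - density h1| / density h1
       + `|temperature h2 - temperature h1| / temperature h1 + k)
       + nu h2 * mass (fun v => `|h1 v - h2 v|)))%:E)%E.
Proof.
have [J J0 hJ] := @L12v_gauss R.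
have [C C0 hC] := powR2_ratio_lipschitz (alpha + 1) (beta - 3 / 2).
pose g : R := 3 * expR (1 / 8); have g0 : 0 < g by rewrite mulr_gt0// expR_gt0.
pose M := C + (1 + 4 * C) * g.
have M0 : 0 < M.
  by rewrite addr_gt0// mulr_gt0// addr_gt0// mulr_gt0.
exists (J * M * gauss_const).
  by apply: mulr_gt0 gauss_const_gt0; exact: mulr_gt0.
move=> eps h1 h2 k f e0 t1 t2 h10 h20 cl.
have T1 := temperature_gt0 q5 e0 t1 h10; have T2 := temperature_gt0 q5 e0 t2 h20.
have rr := close_ratio h10 cl.
case: cl => /andP[r_lo r_hi] TT k04 ef fT.
have k0 : 0 <= k by move: k04 => /andP[].
have amp := hC _ _ _ _ h10 T1 rr TT.
have G0 := gauss_const_gt0; have a10 := gain_amp_ge0 h1.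
have x0 : 0 <= `|density h2 - density h1| / density h1 by rewrite divr_ge0// ltW.
have y0 : 0 <= `|temperature h2 - temperature h1| / temperature h1.
  by rewrite divr_ge0// ltW.
have x1 : `|density h2 - density h1| / density h1 <= 1.
  by rewrite ler_pdivrMr// ler_norml; lra.
have y3 : `|temperature h2 - temperature h1| / temperature h1 <= 3.
  by move: TT => /andP[? ?]; rewrite ler_pdivrMr// ler_norml; lra.
have {}amp : `|gain_amp h2 - gain_amp h1| <= C * gain_amp h1 *
   (`|density h2 - density h1| / density h1
       + `|temperature h2 - temperature h1| / temperature h1).
  rewrite /gain_amp -mulrBr normrM (gtr0_norm G0).
  have := ler_wpM2l (ltW G0) amp; apply: le_eq2 => //; ring.
have gd := @gauss_dist R _ _ _ _ _ _ _ _ T1 TT k04 ef fT.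
set x := `|density h2 - density h1| / _ in amp x0 x1 *.
set y := `|temperature h2 - temperature h1| / _ in amp gd y0 y3 *.
have D0 : 0 <= x + y + k by rewrite !addr_ge0.
apply: (@le_trans _ _ (J * (gain_amp h1 * M * (x + y + k) * energy h1
     * temperature h1 `^ (3 / 2)))%:E).
  apply: (hJ _ (velocity h1)) => //.
  - by apply: measurable_funB; [exact: (gain_measurable t1)|exact: (gain_measurable t2)].
  - by rewrite /energy; lra.
  - by apply: mulr_ge0 D0; apply: mulr_ge0 a10 (ltW M0).
  move=> s v sE; have s0 : 0 <= s by rewrite sE divr_ge0 ?sqnorm_ge0// ltW.
  have {}gd := gd s v sE.
  have e1 := expR_half_le s0.
  rewrite !gainE//; move: gd.
  have -> : sqnorm (v - velocity h1) / (2 * temperature h1) = s / 2.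
    by rewrite sE; field; rewrite gt_eqF.
  have := expR_ge0 (- (s / 2)).
  move: (expR (- (s / 2))) (expR (- (_ / (2 * _)))) e1 => E1 E2 e1 E10 gd.
  have a20 := gain_amp_ge0 h2.
  move: (gain_amp h1) (gain_amp h2) a10 a20 amp => a1 a2 a10 a20 amp.
  apply: product_dist_aux => //; first by rewrite addr_ge0//=; lra.
  apply: (le_trans gd); rewrite -/g -[g * _ * _]mulrA.
  have w0 : 0 <= (1 + s) * expR (- (s / 16)) by exact: le_trans e1.
  apply: ler_wpM2l; first by apply: mulr_ge0 w0; exact: ltW.
  by rewrite lerD2r lerDr.
rewrite lee_fin.
have -> : gain_amp h1 * M * (x + y + k) * energy h1 * temperature h1 `^ (3 / 2)
  = M * gauss_const * (flux alpha beta h1 * (x + y + k)).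
  have := gain_amp_flux h10 T1 => AF.
  transitivity (M * (x + y + k) * (gain_amp h1 * energy h1 * temperature h1 `^ (3 / 2))).
    by ring.
  by rewrite AF; ring.
have m0 : 0 <= nu h2 * mass (fun v => `|h1 v - h2 v|).
  rewrite mulr_ge0 ?collfreq_ge0//.
  by apply: le_trans (density_dist q5 t1 t2).
have -> : J * (M * gauss_const * (flux alpha beta h1 * (x + y + k))) =
  J * M * gauss_const * (flux alpha beta h1 * (x + y + k)) by ring.
have c0 : 0 <= J * M * gauss_const.
  by apply: mulr_ge0; [apply: mulr_ge0|]; exact: ltW.
by rewrite ler_wpM2l ?lerDl.
Qed.

End operators.

(** * Measurability in phase space *)

Section phase_space.
Context {R : realType}.
Implicit Types (k : R3 R -> R3 R -> R) (x v : R3 R).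

Definition pmeasurable k : Prop :=
  measurable_fun [set: mR3 R * mR3 R] (fun z => k z.1 z.2).

(** Written as [x * (x^2)^(-1)], the inverse is a real power of a nonnegative
    number. *)
Lemma measurable_funV d (T : measurableType d) (F : T -> R) :
  measurable_fun setT F -> measurable_fun setT (fun t => (F t)^-1).
Proof.
move=> mF; rewrite (_ : (fun t => _) = (fun t => F t * (F t ^+ 2) `^ (- 1))).
  apply: measurable_funM => //.
  apply: (@measurableT_comp _ _ _ _ _ _ (fun y => y `^ (- 1))) => //.
  exact: measurable_funX.
apply/funext => t; rewrite powR_inv1 ?sqr_ge0//.
by have [->|Fn] := eqVneq (F t) 0; [rewrite invr0 mul0r|field].
Qed.

Lemma measurable_velocity_integral k : pmeasurable k ->
  measurable_fun [set: mR3 R] (fun x => \int[leb3]_v k x v).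
Proof.
move=> mk; apply: measurableT_comp => //.
have mE : measurable_fun [set: mR3 R * mR3 R] (fun z => (k z.1 z.2)%:E).
  exact/measurable_EFinP.
under eq_fun do rewrite integralE.
apply: emeasurable_funB.
- have := @measurable_fun_fubini_tonelli_F _ _ _ _ _ (@leb3 R) _ (measurable_funepos mE)
    (fun z => funepos_ge0 _ z).
  by congr (measurable_fun _ _); apply/funext => x; apply: eq_integral => v _;
    rewrite !funeposE.
- have := @measurable_fun_fubini_tonelli_F _ _ _ _ _ (@leb3 R) _ (measurable_funeneg mE)
    (fun z => funeneg_ge0 _ z).
  by congr (measurable_fun _ _); apply/funext => x; apply: eq_integral => v _;
    rewrite !funenegE.
Qed.

Lemma pmeasurable_slice k x : pmeasurable k -> vmeasurable (k x).
Proof. by move=> mk; exact: (measurableT_comp mk (pair1_measurable x)). Qed.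

Lemma pmeasurable_fst (F : R3 R -> R) : measurable_fun [set: mR3 R] (F : mR3 R -> R) ->
  pmeasurable (fun x _ => F x).
Proof. by move=> mF; exact: (measurableT_comp mF measurable_fst). Qed.

Lemma pmeasurable_snd (F : R3 R -> R) : vmeasurable F -> pmeasurable (fun _ v => F v).
Proof. by move=> mF; exact: (measurableT_comp mF measurable_snd). Qed.

Section moments_measurable.
Variable k : R3 R -> R3 R -> R.
Hypothesis mk : pmeasurable k.

Lemma measurable_density :
  measurable_fun [set: mR3 R] (fun x : mR3 R => density (k x)).
Proof. exact: measurable_velocity_integral. Qed.

Let weighted (F : R3 R -> R) : vmeasurable F ->
  measurable_fun [set: mR3 R] (fun x : mR3 R => \int[leb3]_v (F v * k x v)).
Proof.
move=> mF; apply: (@measurable_velocity_integral (fun x v => F v * k x v)).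
by apply: measurable_funM => //; exact: pmeasurable_snd.
Qed.

Lemma measurable_velocity :
  measurable_fun [set: mR3 R] (fun x : mR3 R => velocity (k x) : mR3 R).
Proof.
have mi := measurable_funV measurable_density.
apply: measurable_fun_pair; first apply: measurable_fun_pair.
- by apply: measurable_funM mi; apply: weighted; exact: measurableT_comp.
- by apply: measurable_funM mi; apply: weighted; exact: measurableT_comp.
- by apply: measurable_funM mi; apply: weighted; exact: measurable_snd.
Qed.

Lemma measurable_sqnorm_comp d (T : measurableType d) (F : T -> mR3 R) :
  measurable_fun setT F -> measurable_fun setT (fun t => sqnorm (F t : R3 R)).
Proof.
move=> mF; exact: (measurableT_comp measurable_sqnorm mF).
Qed.

Lemma measurable_temperature :
  measurable_fun [set: mR3 R] (fun x : mR3 R => temperature (k x)).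
Proof.
apply: measurable_funM => //; apply: measurable_funB.
  apply: measurable_funM; first by apply: weighted; exact: measurable_sqnorm.
  exact: measurable_funV measurable_density.
exact: measurable_sqnorm_comp measurable_velocity.
Qed.

Variables alpha beta : R.
Hypothesis alpha0 : 0 < alpha.

(** For positive [alpha] the power itself vanishes in vacuum, which removes the
    case distinction before measurability is proved. *)
Lemma collfreq_powR h : collfreq alpha beta h
  = density h `^ alpha * temperature h `^ beta.
Proof.
by rewrite /collfreq; case: ifPn => // /eqP ->; rewrite powR0 ?gt_eqF// mul0r.
Qed.

Lemma measurable_powR_comp d (T : measurableType d) (F : T -> R) (p : R) :
  measurable_fun setT F -> measurable_fun setT (fun t => F t `^ p).
Proof. by move=> mF; apply: (@measurableT_comp _ _ _ _ _ _ (fun y => y `^ p)). Qed.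

Lemma pmeasurable_collfreq : pmeasurable (fun x _ => collfreq alpha beta (k x)).
Proof.
apply: pmeasurable_fst; under eq_fun do rewrite collfreq_powR.
apply: measurable_funM; apply: measurable_powR_comp.
  exact: measurable_density.
exact: measurable_temperature.
Qed.

Lemma pmeasurable_loss : pmeasurable (fun x => loss alpha beta (k x)).
Proof. by apply: measurable_funM => //; exact: pmeasurable_collfreq. Qed.

Lemma pmeasurable_gain : pmeasurable (fun x => gain alpha beta (k x)).
Proof.
pose Mx h v : R := density h / (2 * pi * temperature h) `^ (3 / 2)
       * expR (- (sqnorm (v - velocity h) / (2 * temperature h))).
rewrite (_ : (fun x => _) = fun x v => collfreq alpha beta (k x) * Mx (k x) v).
  apply: measurable_funM; first exact: pmeasurable_collfreq.
  apply: measurable_funM.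
    apply: (@pmeasurable_fst (fun x => density (k x) / (2 * pi * temperature (k x)) `^ (3 / 2))).
    apply: measurable_funM; first exact: measurable_density.
    apply: measurable_funV; apply: measurable_powR_comp.
    by apply: measurable_funM => //; exact: measurable_temperature.
  do 2 apply: measurableT_comp => //.
  apply: measurable_funM; last first.
    apply: (@pmeasurable_fst (fun x => (2 * temperature (k x))^-1)).
    apply: measurable_funV.
    by apply: measurable_funM => //; exact: measurable_temperature.
  have mU : measurable_fun [set: mR3 R * mR3 R]
      (fun z : mR3 R * mR3 R => velocity (k z.1) : mR3 R).
    exact: (measurableT_comp measurable_velocity measurable_fst).
  have m1 (i : mR3 R -> R) : measurable_fun [set: mR3 R] i -> measurable_fun [set: mR3 R * mR3 R]
     (fun z : mR3 R * mR3 R => i z.2 - i (velocity (k z.1))).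
    move=> mi; apply: measurable_funB; first exact: measurableT_comp.
    exact: (measurableT_comp mi mU).
  apply: measurable_funD; [apply: measurable_funD|]; apply: measurable_funX.
  - by apply: (m1 (fun v : mR3 R => v.1.1)); exact: measurableT_comp.
  - by apply: (m1 (fun v : mR3 R => v.1.2)); exact: measurableT_comp.
  - by apply: (m1 (fun v : mR3 R => v.2)); exact: measurable_snd.
apply/funext => x; apply/funext => v; rewrite /gain /collfreq /maxwellian.
by case: ifP => //; rewrite !mul0r.
Qed.

End moments_measurable.

Lemma pmeasurableB k1 k2 : pmeasurable k1 -> pmeasurable k2 ->
  pmeasurable (fun x v => k1 x v - k2 x v).
Proof. exact: measurable_funB. Qed.

Lemma pmeasurable_bracketM k : pmeasurable k ->
  measurable_fun [set: mR3 R * mR3 R] (fun z => (bracket z.2 * `|k z.1 z.2|)%:E).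
Proof.
move=> mk; apply/measurable_EFinP; apply: measurable_funM.
  exact: (pmeasurable_snd measurable_bracket).
exact: measurableT_comp.
Qed.

Lemma norm_L12E k : pmeasurable k -> norm_L12 k = (\int[leb3]_x L12v (k x))%E.
Proof.
move=> mk; rewrite /norm_L12.
rewrite (fubini_tonelli1 (fun z : mR3 R * mR3 R => (bracket z.2 * `|k z.1 z.2|)%:E))//.
  exact: pmeasurable_bracketM.
by move=> z; exact: L12v_ge0.
Qed.

Lemma measurable_L12v k : pmeasurable k ->
  measurable_fun [set: mR3 R] (fun x : mR3 R => L12v (k x)).
Proof.
move=> mk; apply: (measurable_fun_fubini_tonelli_F
  (fun z : mR3 R * mR3 R => (bracket z.2 * `|k z.1 z.2|)%:E)).
  exact: pmeasurable_bracketM.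
by move=> z; exact: L12v_ge0.
Qed.

Lemma norm_L12_le (c : R) k1 k2 : 0 <= c -> pmeasurable k1 -> pmeasurable k2 ->
  (forall x, L12v (k1 x) <= c%:E * L12v (k2 x))%E ->
  (norm_L12 k1 <= c%:E * norm_L12 k2)%E.
Proof.
move=> c0 m1 m2 k12; rewrite !norm_L12E//.
have L0 k x : (0 <= L12v (k x))%E by apply: integral_ge0 => v _; exact: L12v_ge0.
rewrite -ge0_integralZl//; last exact: measurable_L12v.
apply: ge0_le_integral => //.
- exact: measurable_L12v.
- by apply: emeasurable_funM => //; exact: measurable_L12v.
Qed.

End phase_space.

Section solution_space.
Context {R : realType}.
Variables (alpha beta q r C eps : R) (f0 : R3 R -> R3 R -> R).
Variable f : R -> R3 R -> R3 R -> R.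
Hypothesis fO : Omega alpha beta q r C f0 eps f.

Lemma Omega_pmeasurable t : 0 <= t -> pmeasurable (f t).
Proof. by move=> t0; case: fO => -[/(_ t t0)[]]. Qed.

Lemma Omega_tame t x : 0 <= t -> tame q eps (f t x).
Proof.
move=> t0; split; first exact: pmeasurable_slice (Omega_pmeasurable t0).
move=> v; case: fO => _ /(_ t x v t0) f_ge0 [fw _] _ _; rewrite f_ge0/=.
have : (`|weight_w q v * f t x v|%:E <= eps%:E)%E.
  apply: le_trans fw; apply: (@le_trans _ _ (norm_w q (f t))).
    by apply: ereal_sup_ubound; exists (x, v).
  by apply: ereal_sup_ubound; exists t.
have w0 : 0 < weight_w q v by apply: powR_gt0; exact: bracket_gt0.
rewrite lee_fin normrM (gtr0_norm w0) (ger0_norm f_ge0) => wf.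
by rewrite powRN ler_pdivlMr ?powR_gt0 ?bracket_gt0// mulrC.
Qed.

End solution_space.

(** * The Lipschitz estimate *)

Theorem proposition4p1 (R : realType) (alpha beta q : R)
  (alpha_gt : 1 / 3 < alpha) (alpha_le : alpha <= 1)
  (beta_ge : 0 <= beta) (beta_le : beta <= 1)
  (alpha_beta : 2 <= 3 * alpha + 2 * beta)
  (q_gt : Num.max (3 + 2 * (1 + beta) / alpha)
                  (3 + 6 * beta / (3 * alpha - 1)) < q) :
  exists2 CLip : R, 0 < CLip &
    forall r : R,
      3 < r < 3 * alpha + 2 - 3 * (3 * alpha + 2 * beta - 1) / q \/ 5 < r ->
    forall C : R, 0 < C ->
    forall f0 : R3 R -> R3 R -> R, (forall x v, 0 <= f0 x v) -> L12 f0 ->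
    exists2 eps0 : R, 0 < eps0 &
      forall eps : R, 0 < eps < eps0 ->
      forall f g : R -> R3 R -> R3 R -> R,
        Omega alpha beta q r C f0 eps f -> Omega alpha beta q r C f0 eps g ->
      forall t : R, 0 <= t ->
        (norm_L12 (fun x v =>
             collfreq alpha beta (f t x) * maxwellian (f t x) v
             - collfreq alpha beta (g t x) * maxwellian (g t x) v)%R
         + norm_L12 (fun x v =>
             collfreq alpha beta (f t x) * f t x v
             - collfreq alpha beta (g t x) * g t x v)%R
         <= (CLip * eps `^ alpha)%:E
            * norm_L12 (fun x v => f t x v - g t x v)%R)%E.
Proof.
have alpha0 : 0 < alpha by lra.
have q1 : 3 + 2 * (1 + beta) / alpha < q by move: q_gt; rewrite gt_max => /andP[].
have alpha_q : 2 * (1 + beta) <= alpha * (q - 3).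
  by rewrite [leRHS]mulrC -ler_pdivrMr//; move: q1; lra.
have q5 : 5 < q.
  have : 2 <= 2 * (1 + beta) / alpha by rewrite ler_pdivlMr//; lra.
  by move: q1; lra.
have [A A0 hA] := lipschitz_scheme alpha0 beta_le alpha_beta q5 alpha_q
  (@gain_measurable R alpha beta q) (@gain_vacuum R alpha beta)
  (gain_size alpha beta q5) (gain_close alpha beta q5).
have [B B0 hB] := lipschitz_scheme alpha0 beta_le alpha_beta q5 alpha_q
  (@loss_measurable R alpha beta q) (@loss_vacuum R alpha beta)
  (loss_size alpha beta q5) (loss_close alpha beta q5).
exists (A + B); first exact: addr_gt0.
move=> r _ C _ f0 _ _; exists 1 => // eps /andP[e0 _] f g fO gO t t0.
have mf := Omega_pmeasurable fO t0; have mg := Omega_pmeasurable gO t0.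
have tf x := Omega_tame fO x t0; have tg x := Omega_tame gO x t0.
have e'0 : 0 <= eps `^ alpha by exact: powR_ge0.
have massE x : (mass (fun v => `|f t x v - g t x v|))%:E
    = L12v (fun v => f t x v - g t x v).
  by rewrite -(L12v_tame q5 (tame_dist (tf x) (tg x))) L12v_normr.
have mfg := pmeasurableB mf mg.
rewrite mulrDl EFinD ge0_muleDl ?lee_fin ?mulr_ge0 ?(ltW A0) ?(ltW B0)//.
apply: leeD.
- apply: (@norm_L12_le _ (A * eps `^ alpha) (fun x v => gain alpha beta (f t x) v
     - gain alpha beta (g t x) v) _ _ _ mfg) => [||x].
  + by rewrite mulr_ge0// ltW.
  + by apply: pmeasurableB; exact: pmeasurable_gain.
  + by rewrite -massE -EFinM; exact: hA.
- apply: (@norm_L12_le _ (B * eps `^ alpha) (fun x v => loss alpha beta (f t x) v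
     - loss alpha beta (g t x) v) _ _ _ mfg) => [||x].
  + by rewrite mulr_ge0// ltW.
  + by apply: pmeasurableB; exact: pmeasurable_loss.
  + by rewrite -massE -EFinM; exact: hB.
Qed.
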